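(* Let $M\in O_{int}$. For every $m\in M$, the element $\Omega_{\le n}m$ is independent of $n$ for $n$ large enough; write $$\Omega(m)=\sum_b(-1)^{\mathrm{ht}|b|+e(|b|)}S(b^-)b^{*+}m$$ for this stable value. Then, as operators on $M$, for all $(i,l)\in I^\infty$, $$K_i^{-l}a_{il}\Omega=K_i^l\Omega a_{il},\qquad \Omega b_{il}=b_{il}K_i^l\Omega K_i^l,\qquad \Omega K_i^l=K_i^l\Omega.$$
   Context: Datum: $I$ is a finite or countably infinite index set, $A=(a_{ij})_{i,j\in I}$ an integer matrix with $a_{ii}\in\{2,0,-2,-4,\dots\}$, $a_{ij}\le0$ for $i\ne j$, and positive integers $d_i$ with $d_ia_{ij}=d_ja_{ji}$; $P$ is a free abelian group, $P^\vee=\mathrm{Hom}(P,\mathbb{Z})$, with linearly independent simple roots $\alpha_i\in P$ and coroots $h_i\in P^\vee$, $\langle h_i,\alpha_j\rangle=a_{ij}$, and elements $\Lambda_i\in P$ with $\langle h_j,\Lambda_i\rangle=\delta_{ij}$; $I=I_{\bar0}\sqcup I_{\bar1}$ with $a_{ij}\in2\mathbb{Z}$ for $i\in I_{\bar1}$, $j\in I$. $Q_+=\sum_i\mathbb{Z}_{\ge0}\alpha_i$. $p(i)=0$ on $I_{\bar0}$, $1$ on $I_{\bar1}$; $p(li)\in\{0,1\}$, $p(li)\equiv l\,p(i)\pmod2$. $I^{\mathrm{re}}=\{a_{ii}=2\}$, $I^{\mathrm{im}}=\{a_{ii}\le0\}$, $I^\infty=(I^{\mathrm{re}}\times\{1\})\sqcup(I^{\mathrm{im}}\times\mathbb{Z}_{>0})$,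 $i$ stands for $(i,1)$. $(\alpha_i,\alpha_j)=d_ia_{ij}$, $q_i=q^{d_i}$. For $i\in I^{\mathrm{re}}$: $[s]_i=\frac{((-1)^{p(i)}q_i)^s-q_i^{-s}}{(-1)^{p(i)}q_i-q_i^{-1}}$, $[n]_i^!=\prod_{s=1}^n[s]_i$, $\begin{bmatrix}n\\t\end{bmatrix}_i=\frac{[n]_i^!}{[t]_i^![n-t]_i^!}$. $F$, form, radical: $F$ is the free unital $\mathbb{Q}(q)$-algebra on $a_{il}$, $(i,l)\in I^\infty$, with parity $p(a_{il})=p(li)$ and weight $|a_{il}|=l\alpha_i$; $F\otimes F$ has product $(x_1\otimes x_2)(x_3\otimes x_4)=(-1)^{p(x_2)p(x_3)}q^{(|x_2|,|x_3|)}x_1x_3\otimes x_2x_4$; $\varrho:F\to F\otimes F$ is the algebra homomorphism with $\varrho(a_{il})=a_{il}\otimes1+1\otimes a_{il}$. $(\cdot,\cdot)$ is the unique (symmetric) bilinear form on $F$ with $(1,1)=1$, $(a_{il},a_{jk})=\delta_{ij}\delta_{lk}(1-(-1)^{p(li)}q_i^{2l})^{-1}$, $(x,yy')=(\varrho(x),y\otimes y')$, $(xx',y)=(x\otimes x',\varrho(y))$, where $(x_1\otimes x_2,x_3\otimes x_4)=(x_1,x_3)(x_2,x_4)$; $\mathscr{R}$ is its radical, and the form descends to a nondegenerate form on $F/\mathscr{R}$. $U=U_q(\mathfrak g)$ is the associative $\mathbb{Q}(q)$-superalgebra generated by $a_{il},b_{il}$ ($(i,l)\in I^\infty$) of parity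 $p(li)$ and even $q^h$ ($h\in P^\vee$), with relations $q^0=1$, $q^hq^{h'}=q^{h+h'}$, $q^ha_{il}q^{-h}=q^{l\langle h,\alpha_i\rangle}a_{il}$, $q^hb_{il}q^{-h}=q^{-l\langle h,\alpha_i\rangle}b_{il}$; $\sum_{t+t'=1-ka_{ij}}(-1)^{t'}(-1)^{p(i)(t'p(kj)+\binom{t'}2)}\begin{bmatrix}1-ka_{ij}\\t'\end{bmatrix}_ia_i^ta_{jk}a_i^{t'}=0$ for $i\in I^{\mathrm{re}}$, $(i,1)\ne(j,k)\in I^\infty$, and the same with $b$'s in place of $a$'s; $a_{il}a_{jk}-(-1)^{p(li)p(kj)}a_{jk}a_{il}=b_{il}b_{jk}-(-1)^{p(li)p(kj)}b_{jk}b_{il}=0$ if $a_{ij}=0$; $a_{il}b_{jk}-(-1)^{p(li)p(kj)}b_{jk}a_{il}=\delta_{ij}\delta_{kl}\frac{K_i^l-K_i^{-l}}{1-(-1)^{p(li)}q_i^{2l}}$, where $K_i^l=q^{ld_ih_i}$. $U^+,U^-$ are the subalgebras generated by the $a_{il}$, resp. the $b_{il}$. For $x\in F$, $x^+$ and $x^-$ are the images of $x$ under the algebra homomorphisms $F\to U$ sending $a_{il}\mapsto a_{il}$ and $a_{il}\mapsto b_{il}$. As a standing convention, these maps are regarded as factoring through $F/\mathscr{R}$ and identifying $F/\mathscr{R}$ with $U^+$ and with $U^-$. $S:U\to U$ is the unique $\mathbb{Q}(q)$-linear map with $S(a_{il})=-K_i^{-l}a_{il}$, $S(b_{il})=-b_{il}K_i^l$,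 $S(q^h)=q^{-h}$, and $S(xy)=(-1)^{p(x)p(y)}S(y)S(x)$ for homogeneous $x,y$. Elements of $\mathbb{N}I^\infty$ are finite formal sums $\alpha=\sum_p(i_p,l_p)$; $U^+_\alpha$ is the span of products of generators $a_{il}$ in which each $(i,l)$ occurs with its multiplicity in $\alpha$; $\mathrm{ht}\,\alpha$ is the number of terms of $\alpha$; $e(\alpha)=\sum_{p<p'}p(l_pi_p)p(l_{p'}i_{p'})$. $B_\alpha$ is a basis of $U^+_\alpha$ and $\{b^*\}_{b\in B_\alpha}$ its dual basis with respect to $(\cdot,\cdot)$; for $b\in B_\alpha$, $|b|$ in the formula for $\Omega$ means $\alpha$. $\Omega_{\le n}=\sum_{\mathrm{ht}\,\alpha\le n}\sum_{b\in B_\alpha}(-1)^{\mathrm{ht}\,\alpha+e(\alpha)}S(b^-)b^{*+}$ (on any vector of a module in $O_{int}$ only finitely many terms act nontrivially). $O_{int}$ consists of the ($\mathbb{Z}_2$-graded, $M=M_{\bar0}\oplus M_{\bar1}$) $U$-modules $M$ such that: (a) $M=\bigoplus_{\mu\in P}M_\mu$ with $M_\mu=\{m:q^hm=q^{\langle h,\mu\rangle}m\ \forall h\in P^\vee\}$ ($\mathbb{Z}_2$-graded subspaces) and $\dim M_\mu<\infty$; (b) there are finitely many $\lambda_1,\dots,\lambda_r\in P$ with $\mathrm{wt}(M)=\{\mu:M_\mu\neq0\}\subset\bigcup_j(\lambda_j-Q_+)$; (c) for $i\in I^{\mathrm{re}}$, $b_i$ is locally nilpotent on $M$; (d) for $i\in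 I^{\mathrm{im}}$, $\langle h_i,\mu\rangle\ge0$ for all $\mu\in\mathrm{wt}(M)$; (e) if $i\in I^{\mathrm{im}}$ and $\langle h_i,\mu\rangle=0$, then $b_{il}M_\mu=0$ for all $l>0$; (f) if $i\in I^{\mathrm{im}}$, $l>0$ and $\langle h_i,\mu\rangle\le-la_{ii}$, then $a_{il}M_\mu=0$. *)

(* Defs.v *)
Set Warnings "-notation-overridden,-notation-incompatible-prefix,-ambiguous-paths,-redundant-canonical-projection".
From HB Require Import structures.
From mathcomp Require Import all_boot all_order all_algebra.
From mathcomp Require Import finmap multiset.
From mathcomp Require Import boolp classical_sets functions cardinality fsbigop.
From mathcomp Require Import monalg.

Set Implicit Arguments.
Unset Strict Implicit.
Unset Printing Implicit Defensive.

Import Order.TTheory GRing.Theory Num.Theory.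

Local Open Scope mset_scope.
Local Open Scope classical_set_scope.
Local Open Scope ring_scope.

Definition Qq : fieldType := {fraction {poly rat}}.
Definition q : Qq := tofrac ('X : {poly rat}).

Definition Pdual (P : zmodType) : Type := {additive P -> int}.
HB.instance Definition _ (P : zmodType) := gen_eqMixin (Pdual P).
HB.instance Definition _ (P : zmodType) := gen_choiceMixin (Pdual P).

Definition Zindependent (V : zmodType) (J : eqType) (v : J -> V) : Prop :=
  forall (s : seq J) (c : J -> int), uniq s ->
    \sum_(j <- s) v j *~ c j = 0 -> forall j, j \in s -> c j = 0.

Definition Zindependent_dual (P : zmodType) (J : eqType) (v : J -> Pdual P) :
    Prop :=
  forall (s : seq J) (c : J -> int), uniq s ->
    (forall x : P, \sum_(j <- s) c j * v j x = 0) ->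
    forall j, j \in s -> c j = 0.

Definition free_abelian (P : zmodType) : Prop :=
  exists (J : choiceType) (e : J -> P), Zindependent e /\
    forall x : P, exists (s : seq J) (c : J -> int),
      x = \sum_(j <- s) e j *~ c j.

(* symd i is d_i, fweight i is Lambda_i, and I_1 is the set of i with isodd i. *)
Record datum := Datum {
  idx : countType;
  cartan : idx -> idx -> int;
  symd : idx -> nat;
  wlat : zmodType;
  alpha : idx -> wlat;
  coroot : idx -> Pdual wlat;
  fweight : idx -> wlat;
  isodd : pred idx;
  _ : forall i, cartan i i = 2 \/ (cartan i i <= 0 /\ (2 %| cartan i i)%Z);
  _ : forall i j, i != j -> cartan i j <= 0;
  _ : forall i, (0 < symd i)%N;
  _ : forall i j, (symd i)%:Z * cartan i j = (symd j)%:Z * cartan j i;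
  _ : free_abelian wlat;
  _ : Zindependent alpha;
  _ : Zindependent_dual coroot;
  _ : forall i j, coroot i (alpha j) = cartan i j;
  _ : forall i j, coroot j (fweight i) = (i == j)%:R;
  _ : forall i j, isodd i -> (2 %| cartan i j)%Z
}.

(* The algebra of the free monoid on G, i.e. the free unital algebra on G. *)
Notation freealg G := {malg Qq[{fmonom G}]}.

Section Definitions.

Variable D : datum.

Local Notation I := (idx D).
Local Notation P := (wlat D).
Local Notation A := (@cartan D).
Local Notation d := (@symd D).

Definition isreal (i : I) : bool := A i i == 2.
Definition isimag (i : I) : bool := A i i <= 0.

Definition Qplus : set P :=
  [set b | exists (s : seq I) (c : I -> nat), b = \sum_(i <- s) alpha i *+ c i].

(* I^oo, as a subtype of I * nat. *)
Definition inf_pred (x : I * nat) : bool :=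
  (isreal x.1 && (x.2 == 1%N)) || (isimag x.1 && (0 < x.2)%N).
Definition Iinf : countType := {x : I * nat | inf_pred x}.

Definition ix (x : Iinf) : I := (sval x).1.
Definition lv (x : Iinf) : nat := (sval x).2.

(* The parity p(l i). *)
Definition par (x : Iinf) : bool := odd (lv x) && isodd (ix x).

(* (l alpha_i, k alpha_j) for x = (i, l) and y = (j, k), where
   (alpha_i, alpha_j) = d_i a_{ij}. *)
Definition wpair (x y : Iinf) : int :=
  (lv x)%:Z * (lv y)%:Z * ((d (ix x))%:Z * A (ix x) (ix y)).

Definition qi (i : I) : Qq := q ^+ d i.
Definition sgn (b : bool) : Qq := (-1) ^+ b.

Definition qint (i : I) (s : nat) : Qq :=
  ((sgn (isodd i) * qi i) ^+ s - qi i ^- s)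
  / (sgn (isodd i) * qi i - (qi i)^-1).
Definition qfact (i : I) (n : nat) : Qq := \prod_(1 <= s < n.+1) qint i s.
Definition qbinom (i : I) (n t : nat) : Qq :=
  qfact i n / (qfact i t * qfact i (n - t)).

(* (a_{il}, a_{il}) is the inverse of this scalar. *)
Definition gden (x : Iinf) : Qq := 1 - sgn (par x) * qi (ix x) ^+ (2 * lv x).

Definition gen (G : choiceType) (g : G) : freealg G := << fmu g >>.

Definition word_par (G : choiceType) (p : pred G) (w : {fmonom G}) : bool :=
  \big[addb/false]_(g <- (w : seq G)) p g.

(* The algebra homomorphism sending each generator g to f g. *)
Definition freeval (G : choiceType) (U : algType Qq) (f : G -> U)
    (x : freealg G) : U :=
  \sum_(w <- msupp x) x@_w *: \prod_(g <- (w : seq G)) f g.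

Local Notation F := (freealg Iinf).
Local Notation W := {fmonom Iinf}.

(* F (x) F, with basis the pairs of words. *)
Local Notation FF := {malg Qq[(W * W)%type]}.

Definition tens (x y : F) : FF :=
  \sum_(u <- msupp x) \sum_(v <- msupp y) << x@_u * y@_v *g (u, v) >>.

(* (|u|, |v|), where the weight |u| is the sum of the l alpha_i over the letters
   (i, l) of u. *)
Definition word_pair (u v : W) : int :=
  \sum_(x <- (u : seq Iinf)) \sum_(y <- (v : seq Iinf)) wpair x y.

Definition tmul (s t : FF) : FF :=
  \sum_(u <- msupp s) \sum_(v <- msupp t)
    << s@_u * t@_v * sgn (word_par par u.2 && word_par par v.1)
         * q ^ word_pair u.2 v.1
       *g (mmul u.1 v.1, mmul u.2 v.2) >>.

Definition rho_gen (x : Iinf) : FF := tens (gen x) 1 + tens 1 (gen x).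
Definition rho_word (w : W) : FF :=
  foldr (fun x => tmul (rho_gen x)) (tens 1 1) (w : seq Iinf).
Definition rho (x : F) : FF := \sum_(w <- msupp x) x@_w *: rho_word w.

Definition tform (B : F -> F -> Qq) (s t : FF) : Qq :=
  \sum_(u <- msupp s) \sum_(v <- msupp t)
    s@_u * t@_v * (B << u.1 >> << v.1 >> * B << u.2 >> << v.2 >>).

(* These conditions determine B uniquely. *)
Record is_form (B : F -> F -> Qq) : Prop := IsForm {
  form_linl : forall y, scalar (B^~ y);
  form_linr : forall x, scalar (B x);
  form_sym : forall x y, B x y = B y x;
  form_11 : B 1 1 = 1;
  form_gen : forall x y, B (gen x) (gen y) = (x == y)%:R / gden x;
  form_mulr : forall x y y', B x (y * y') = tform B (rho x) (tens y y');
  form_mull : forall x x' y, B (x * x') y = tform B (tens x x') (rho y)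
}.

Definition radical (B : F -> F -> Qq) : set F :=
  [set x | forall y, B x y = 0].

Definition Ugen : choiceType := (Iinf + Iinf + Pdual P)%type.

Local Notation TU := (freealg Ugen).

Definition fa (x : Iinf) : TU := gen (inl (inl x) : Ugen).
Definition fb (x : Iinf) : TU := gen (inl (inr x) : Ugen).
Definition fq (h : Pdual P) : TU := gen (inr h : Ugen).

Definition Ugen_par (g : Ugen) : bool :=
  match g with inl (inl x) => par x | inl (inr x) => par x | inr _ => false end.

(* z d_i h_i, so that K_i^z is q^(z d_i h_i). *)
Definition dcoroot (z : int) (i : I) : Pdual P :=
  ((z * (d i)%:Z) \*o coroot i : {additive P -> int}).

(* The exponent 1 - k a_{ij}, where i is the index of y and (j, k) = x; it is
   nonnegative whenever y is real and x <> y. *)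
Definition serre_exp (y x : Iinf) : nat :=
  absz (1 - (lv x)%:Z * A (ix y) (ix x))%R.

Definition serre (f : Iinf -> TU) (y x : Iinf) : TU :=
  \sum_(t < (serre_exp y x).+1)
    ((-1) ^+ t * (-1) ^+ (isodd (ix y) * (t * par x + 'C(t, 2)))
      * qbinom (ix y) (serre_exp y x) t)
    *: (f y ^+ (serre_exp y x - t) * f x * f y ^+ t).

Definition scomm (u v : TU) (p p' : bool) : TU :=
  u * v - sgn (p && p') *: (v * u).

(* The relators of U: each relation "u = v" is listed as u - v. *)
Inductive Urelator : TU -> Prop :=
| Urel_q0 : Urelator (fq (\0 : {additive P -> int}) - 1)
| Urel_qD (h h' : Pdual P) :
    Urelator (fq h * fq h' - fq (h \+ h' : {additive P -> int}))
| Urel_qa (h : Pdual P) (x : Iinf) :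
    Urelator (fq h * fa x * fq (\- h : {additive P -> int})
              - q ^ ((lv x)%:Z * h (alpha (ix x))) *: fa x)
| Urel_qb (h : Pdual P) (x : Iinf) :
    Urelator (fq h * fb x * fq (\- h : {additive P -> int})
              - q ^ (- ((lv x)%:Z * h (alpha (ix x)))) *: fb x)
| Urel_serre_a (y x : Iinf) : isreal (ix y) -> y != x -> Urelator (serre fa y x)
| Urel_serre_b (y x : Iinf) : isreal (ix y) -> y != x -> Urelator (serre fb y x)
| Urel_aa (x y : Iinf) : A (ix x) (ix y) = 0 ->
    Urelator (scomm (fa x) (fa y) (par x) (par y))
| Urel_bb (x y : Iinf) : A (ix x) (ix y) = 0 ->
    Urelator (scomm (fb x) (fb y) (par x) (par y))
| Urel_ab (x y : Iinf) :
    Urelator (scomm (fa x) (fb y) (par x) (par y)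
              - ((x == y)%:R / gden x)
                *: (fq (dcoroot (lv x)%:Z (ix x))
                    - fq (dcoroot (- (lv x)%:Z) (ix x)))).

Inductive two_sided_ideal (R : nzRingType) (E : R -> Prop) : R -> Prop :=
| Ideal_gen r : E r -> two_sided_ideal E r
| Ideal_0 : two_sided_ideal E 0
| Ideal_add r s :
    two_sided_ideal E r -> two_sided_ideal E s -> two_sided_ideal E (r + s)
| Ideal_mull x r : two_sided_ideal E r -> two_sided_ideal E (x * r)
| Ideal_mulr r x : two_sided_ideal E r -> two_sided_ideal E (r * x).

(* U, through the projection pi, is the quotient of the free algebra on the
   generators by the two-sided ideal generated by the relators. *)
Definition presents (U : algType Qq) (pi : {lrmorphism TU -> U}) : Prop :=
  (forall u, exists x, pi x = u) /\
  (forall x, pi x = 0 <-> two_sided_ideal Urelator x).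

Section QuantumGroup.

Variables (U : algType Qq) (pi : {lrmorphism TU -> U}).

Definition ua (x : Iinf) : U := pi (fa x).
Definition ub (x : Iinf) : U := pi (fb x).
Definition uq (h : Pdual P) : U := pi (fq h).

(* For x = (i, l), the elements K_i^l and K_i^{-l}. *)
Definition uK (x : Iinf) : U := uq (dcoroot (lv x)%:Z (ix x)).
Definition uKV (x : Iinf) : U := uq (dcoroot (- (lv x)%:Z) (ix x)).

(* The homogeneous elements of U of parity e. *)
Definition Uhom (e : bool) : set U :=
  [set u | exists2 x : TU,
     (forall w, w \in msupp x -> word_par Ugen_par w = e) & pi x = u].

Definition plus (x : F) : U := freeval ua x.
Definition minus (x : F) : U := freeval ub x.

(* x |-> x^+ and x |-> x^- induce isomorphisms of F / R onto U^+ and U^-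
   (surjectivity holds by definition of U^+ and U^-). *)
Definition identifies (B : F -> F -> Qq) : Prop :=
  forall x : F,
    (plus x = 0 <-> radical B x) /\ (minus x = 0 <-> radical B x).

(* A representative in F of u in U^+ = F / R; the form on U^+ and the map
   U^+ -> U^-, x^+ |-> x^-, do not depend on it when "identifies" holds. *)
Definition rep (u : U) : F := xget 0 [set x | plus x = u].
Definition formU (B : F -> F -> Qq) (u v : U) : Qq := B (rep u) (rep v).
Definition toUminus (u : U) : U := minus (rep u).

Record is_antipode (S : U -> U) : Prop := IsAntipode {
  antipode_linear : linear S;
  antipode_a : forall x, S (ua x) = - (uKV x * ua x);
  antipode_b : forall x, S (ub x) = - (ub x * uK x);
  antipode_q : forall h, S (uq h) = uq (\- h : {additive P -> int});
  antipode_mul : forall e e' u v, Uhom e u -> Uhom e' v ->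
    S (u * v) = (-1) ^+ (e && e') * (S v * S u)
}.

Definition NIinf : choiceType := {mset Iinf}.

Definition ht (al : NIinf) : nat := size (enum_mset al).

(* e(al); enumerating al in another order does not change the sum. *)
Definition esign (al : NIinf) : nat :=
  let t := in_tuple (enum_mset al) in
  \sum_(r < size (enum_mset al)) \sum_(r' < size (enum_mset al) | (r < r')%N)
    par (tnth t r) * par (tnth t r').

Definition Uplus (al : NIinf) : set U :=
  [set u | exists2 x : F,
     (forall w, w \in msupp x -> forall g : Iinf, count_mem g w = al g)
     & plus x = u].

(* The finite sequence Bs al is a basis of U^+_al, for each al. *)
Record is_basis (Bs : NIinf -> seq U) : Prop := IsBasis {
  basis_uniq : forall al, uniq (Bs al);
  basis_mem : forall al b, b \in Bs al -> Uplus al b;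
  basis_free : forall al (c : U -> Qq),
    \sum_(b <- Bs al) c b *: b = 0 -> forall b, b \in Bs al -> c b = 0;
  basis_span : forall al u, Uplus al u ->
    exists c : U -> Qq, u = \sum_(b <- Bs al) c b *: b
}.

(* st al b is the dual basis vector b^* of b in Bs al. *)
Record is_dual_basis (B : F -> F -> Qq) (Bs : NIinf -> seq U)
    (st : NIinf -> U -> U) : Prop := IsDualBasis {
  dual_mem : forall al b, b \in Bs al -> Uplus al (st al b);
  dual_form : forall al b b', b \in Bs al -> b' \in Bs al ->
    formU B b (st al b') = (b == b')%:R
}.

Section Modules.

Variable M : lmodType U.

(* M is a vector space over Qq through the structure map of the algebra U. *)
Definition kscale (c : Qq) (m : M) : M := (c%:A : U) *: m.

Definition wspace (mu : P) : set M :=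
  [set m | forall h : Pdual P, uq h *: m = kscale (q ^ h mu) m].

Definition is_weight (mu : P) : Prop := exists2 m, wspace mu m & m <> 0.

(* Mp e is the part of parity e; e = false for M_0 and e = true for M_1. *)
Record is_graded (Mp : bool -> set M) : Prop := IsGraded {
  graded_add : forall e m m', Mp e m -> Mp e m' -> Mp e (m + m');
  graded_scale : forall e c (m : M), Mp e m -> Mp e (kscale c m);
  graded_dec : forall m : M, exists m0 m1,
    [/\ Mp false m0, Mp true m1 & m = m0 + m1];
  graded_dir : forall m, Mp false m -> Mp true m -> m = 0;
  graded_act : forall e e' u m, Uhom e u -> Mp e' m -> Mp (e (+) e') (u *: m)
}.

Record in_Oint (Mp : bool -> set M) : Prop := InOint {
  Oint_graded : is_graded Mp;
  Oint_sum : forall m, exists (s : seq P) (f : P -> M),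
    (forall mu, wspace mu (f mu)) /\ m = \sum_(mu <- s) f mu;
  Oint_direct : forall (s : seq P) (f : P -> M), uniq s ->
    (forall mu, wspace mu (f mu)) -> \sum_(mu <- s) f mu = 0 ->
    forall mu, mu \in s -> f mu = 0;
  Oint_wgraded : forall mu m0 m1, Mp false m0 -> Mp true m1 ->
    wspace mu (m0 + m1) -> wspace mu m0 /\ wspace mu m1;
  Oint_findim : forall mu, exists vs : seq M, forall m, wspace mu m ->
    exists c : M -> Qq, m = \sum_(v <- vs) kscale (c v) v;
  Oint_wt : exists ls : seq P, forall mu, is_weight mu ->
    exists2 l, l \in ls & exists2 b, Qplus b & mu = l - b;
  Oint_nilp : forall x : Iinf, isreal (ix x) ->
    forall m : M, exists n : nat, ub x ^+ n *: m = 0;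
  Oint_dom : forall i mu, isimag i -> is_weight mu -> 0 <= coroot i mu;
  Oint_b0 : forall (x : Iinf) mu, isimag (ix x) -> coroot (ix x) mu = 0 ->
    forall m : M, wspace mu m -> ub x *: m = 0;
  Oint_a0 : forall (x : Iinf) mu, isimag (ix x) ->
    coroot (ix x) mu <= - ((lv x)%:Z * A (ix x) (ix x)) ->
    forall m : M, wspace mu m -> ua x *: m = 0
}.

Variables (S : U -> U) (Bs : NIinf -> seq U) (st : NIinf -> U -> U).

Definition Omega_term (al : NIinf) (m : M) : M :=
  \sum_(b <- Bs al)
    ((-1) ^+ (ht al + esign al) * (S (toUminus b) * st al b)) *: m.

(* Finitely supported sum over the (in general infinite) set of al with
   ht al <= n. *)
Definition Omega_le (n : nat) (m : M) : M :=
  \sum_(al \in [set al : NIinf | (ht al <= n)%N]) Omega_term al m.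

End Modules.
End QuantumGroup.
End Definitions.

(* Main.v *)
Require Import Defs.
Set Warnings "-notation-overridden,-notation-incompatible-prefix,-ambiguous-paths,-redundant-canonical-projection".
From HB Require Import structures.
From mathcomp Require Import all_boot all_order all_algebra.
From mathcomp Require Import finmap multiset.
From mathcomp Require Import boolp classical_sets functions cardinality fsbigop.
From mathcomp Require Import monalg.
Set Implicit Arguments.
Unset Strict Implicit.
Unset Printing Implicit Defensive.
Import GRing.Theory.
Local Open Scope classical_set_scope.
Local Open Scope ring_scope.

(** Write [Om al] for the part of degree [al] of the operator Omega. In the free
algebra, the coproduct components whose left, respectively right, factor is the
generator [x] define two skew derivations [dl x] and [dr x]. They play two roles.

They are adjoint to multiplication by [x] on the left and on the right
([form_genl], [form_genr]); hence words in different letters are orthogonal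
([form_orth]). They also appear as commutators: moving [a x] past a word in the
[b]'s, or [b x] past a word in the [a]'s, leaves the two skew derivatives of that
word multiplied by [K x] and by its inverse ([a_N], [P_b]); the antipode turns the
first formula into one for the factors S(b^-) of Omega ([a_SN_homs]).

Now multiply [Om al] by [K x ^-1 a x] on the left. The commutation formula gives
one term where [a x] has moved past S(b^-), called [Xa x al], and two terms in
which [b] is replaced by one of its skew derivatives. Since the sum over a basis
and its dual basis is a canonical element, a skew derivative acting on one side can
be exchanged for its adjoint, a multiplication, on the other
([canonical_adjoint]). The two terms then become sums over the degree [be] with [al = x + be], and the sign of [Om al]
relative to that of [Om be] makes them [- Xa x be] and [K x * Om be * a x]
([a_Om_add]). If [x] does not occur in [al] the derivatives vanish and only
[Xa x al] is left ([a_Om_notin]). Multiplication by [b x] on the right is treated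
in the same way, with error terms [Yb x al] ([Om_b_add], [Om_b_notin]), and [K x]
commutes with each [Om al] because the weights of its two factors cancel ([Om_K]).

On a fixed vector of an integrable module only finitely many degrees contribute:
the weights are bounded above, and linear independence of the simple roots leaves
finitely many words that can raise a given weight and stay below a given bound
([finite_words_below], [finitely_many_degrees]). This gives the stable value of
Omega, and summing over all degrees makes the error terms cancel
([telescoping_sum]), which leaves the three identities. *)

(** * Linear extension from a basis of monomials *)

Section LinearExtension.
Variables (K : choiceType) (V : lmodType Qq).
Implicit Types (h : K -> V) (t : {malg Qq[K]}).

Definition lext h t : V := \sum_(k <- msupp t) t@_k *: h k.

Lemma lextEw h (E : {fset K}) t : (msupp t `<=` E)%fset ->
  lext h t = \sum_(k <- E) t@_k *: h k.
Proof.
move=> tE; rewrite /lext (big_fset_incl _ tE) //= => k _ kt.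
by rewrite mcoeff_outdom ?scale0r.
Qed.

Lemma lext_is_linear h : linear (lext h).
Proof.
move=> c s t; pose E := (msupp s `|` msupp t)%fset.
have sE : (msupp s `<=` E)%fset by apply: fsubsetUl.
have tE : (msupp t `<=` E)%fset by apply: fsubsetUr.
have stE : (msupp (c *: s + t)%R `<=` E)%fset.
  apply: fsubset_trans (msuppD_le _ _) _.
  by apply: fsetUSS; [apply: msuppZ_le | apply: fsubset_refl].
rewrite (lextEw h sE) (lextEw h tE) (lextEw h stE) scaler_sumr -big_split /=.
by apply: eq_bigr => k _; rewrite mcoeffD mcoeffZ scalerDl scalerA.
Qed.

HB.instance Definition _ h :=
  GRing.isLinear.Build Qq {malg Qq[K]} V *:%R (lext h) (lext_is_linear h).

Lemma lextD h : {morph lext h : s t / s + t}.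
Proof. exact: linearD. Qed.

Lemma lextZ h c t : lext h (c *: t) = c *: lext h t.
Proof. exact: linearZ. Qed.

Lemma lextU h k : lext h << k >> = h k.
Proof. by rewrite /lext msuppU oner_eq0 big_seq_fset1 mcoeffUU scale1r. Qed.

Lemma eq_lext h1 h2 t : h1 =1 h2 -> lext h1 t = lext h2 t.
Proof. by move=> h12; apply: eq_bigr => k _; rewrite h12. Qed.

Lemma scale_malgU (c : Qq) (k : K) : c *: << k >> = << c *g k >>.
Proof.
apply/malgP => l; rewrite mcoeffZ !mcoeffU.
by case: eqP; rewrite ?mulr1n ?mulr1 ?mulr0n ?mulr0.
Qed.

Lemma malg_sum t : t = \sum_(k <- msupp t) t@_k *: << k >>.
Proof.
by rewrite {1}[t]monalgE; apply: eq_bigr => k _; rewrite scale_malgU.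
Qed.

Lemma linear_malg_sum (f : {malg Qq[K]} -> V) t : linear f ->
  f t = \sum_(k <- msupp t) t@_k *: f << k >>.
Proof.
move=> lf.
pose f' : {linear {malg Qq[K]} -> V} := HB.pack f (GRing.isLinear.Build _ _ _ _ f lf).
rewrite {1}[t]malg_sum; transitivity (f' (\sum_(k <- msupp t) t@_k *: << k >>)) => //.
by rewrite linear_sum; apply: eq_bigr => k _; rewrite linearZ.
Qed.

Lemma eq_linear_supp (f g : {malg Qq[K]} -> V) t : linear f -> linear g ->
  (forall k, k \in msupp t -> f << k >> = g << k >>) -> f t = g t.
Proof.
move=> lf lg fg; rewrite (linear_malg_sum _ lf) (linear_malg_sum _ lg).
by apply: eq_big_seq => k kt; rewrite fg.
Qed.

Lemma eq_linear (f g : {malg Qq[K]} -> V) : linear f -> linear g ->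
  (forall k, f << k >> = g << k >>) -> f =1 g.
Proof. by move=> lf lg fg t; apply: eq_linear_supp => // k _. Qed.

End LinearExtension.

Lemma linear_lext (K : choiceType) (V V' : lmodType Qq) (f : V -> V') (h : K -> V)
  (t : {malg Qq[K]}) : linear f -> f (lext h t) = lext (fun k => f (h k)) t.
Proof.
move=> lf; pose f' : {linear V -> V'} := HB.pack f (GRing.isLinear.Build _ _ _ _ f lf).
transitivity (f' (lext h t)) => //.
by rewrite linear_sum; apply: eq_bigr => k _; rewrite linearZ.
Qed.

Section LinearCombinators.
Variables (V W : lmodType Qq) (A : algType Qq).

Lemma linear_fun (f : {linear V -> W}) : linear f.
Proof. by move=> c x y; rewrite linearP. Qed.

Lemma linear_id : linear (fun x : V => x).
Proof. by []. Qed.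

Lemma linear_comp (f : {linear V -> W}) (X : lmodType Qq) (g : X -> V) :
  linear g -> linear (fun x => f (g x)).
Proof. by move=> lg c x y; rewrite lg linearP. Qed.

Lemma linear_mull (a : A) (f : V -> A) : linear f -> linear (fun x => a * f x).
Proof. by move=> lf c x y; rewrite lf mulrDr scalerAr. Qed.

Lemma linear_mulr (a : A) (f : V -> A) : linear f -> linear (fun x => f x * a).
Proof. by move=> lf c x y; rewrite lf mulrDl scalerAl. Qed.

Lemma linear_add (f g : V -> W) : linear f -> linear g ->
  linear (fun x => f x + g x).
Proof. by move=> lf lg c x y; rewrite lf lg scalerDr addrACA. Qed.

Lemma linear_opp (f : V -> W) : linear f -> linear (fun x => - f x).
Proof. by move=> lf c x y; rewrite lf opprD scalerN. Qed.

Lemma linear_scale (k : Qq) (f : V -> W) : linear f ->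
  linear (fun x => k *: f x).
Proof. by move=> lf c x y; rewrite lf scalerDr !scalerA mulrC. Qed.

End LinearCombinators.

Ltac lin := repeat first
  [ assumption | exact: linear_fun | exact: linear_id
  | apply: linear_add | apply: linear_opp | apply: linear_scale
  | apply: linear_mull | apply: linear_mulr | apply: linear_comp ].

(** * Words, skew derivations and the form *)

Section FreeAlgebra.
Variables (K : monomType) (R : comNzRingType).

Lemma malg_scalerAr (c : R) (y z : {malg R[K]}) : c *: (y * z) = y * (c *: z).
Proof.
have scaleE (u : {malg R[K]}) : c *: u = u * c%:MP.
  rewrite malgZ_def malgM_def fgmulgU; apply: eq_bigr => k _.
  by rewrite mulm1 mulrC.
by rewrite !scaleE mulrA.
Qed.

End FreeAlgebra.

(** Sealed, so that comparing two words never unfolds finitely supported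
functions. *)
HB.lock Definition mon (G : choiceType) (s : seq G) : freealg G :=
  << FMonom s >>.

Section Words.
Variable G : choiceType.
Implicit Types (g : G) (s t : seq G) (z : freealg G).

Lemma monE (w : {fmonom G}) : << w >> = mon w.
Proof. by rewrite mon.unlock; case: w. Qed.

Lemma lext_mon (V : lmodType Qq) (h : {fmonom G} -> V) s :
  lext h (mon s) = h (FMonom s).
Proof. by rewrite mon.unlock lextU. Qed.

Lemma monM s t : mon s * mon t = mon (s ++ t).
Proof.
rewrite !mon.unlock malgM_def fgmulUU mul1r; congr << _ >>.
by apply/eqP; rewrite fmP fmM.
Qed.

Lemma genE g : gen g = mon [:: g].
Proof. by rewrite mon.unlock; congr << _ >>; apply/eqP; rewrite fmP fmU. Qed.

Lemma mon0 : mon ([::] : seq G) = 1.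
Proof. by rewrite mon.unlock; congr << _ >>; apply/eqP; rewrite fmP fm1. Qed.

Lemma mon_cons g s : mon (g :: s) = gen g * mon s.
Proof. by rewrite genE monM. Qed.

Lemma msupp_mon s : msupp (mon s) = [fset FMonom s]%fset.
Proof. by rewrite mon.unlock msuppU oner_eq0. Qed.

(** Homogeneity for the grading by multisets of letters; the degree is given by
any word [t] of that degree. *)
Definition homs t z : Prop := forall w, w \in msupp z -> perm_eq w t.

Lemma homs_mon s t : perm_eq s t -> homs t (mon s).
Proof. by move=> st w; rewrite msupp_mon inE => /eqP->. Qed.

Lemma homs_perm s t z : perm_eq s t -> homs s z -> homs t z.
Proof. by move=> st hz w /hz ws; apply: perm_trans ws st. Qed.

Lemma homs0 t : homs t 0.
Proof. by move=> w; rewrite msupp0. Qed.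

Lemma homsD t y z : homs t y -> homs t z -> homs t (y + z).
Proof.
move=> hy hz w /(fsubsetP (msuppD_le _ _)); rewrite inE => /orP[/hy|/hz] //.
Qed.

Lemma homsZ t c z : homs t z -> homs t (c *: z).
Proof. by move=> hz w /(fsubsetP (msuppZ_le _ _)) /hz. Qed.

Lemma homs_sum (J : eqType) (r : seq J) (f : J -> freealg G) t :
  (forall j, j \in r -> homs t (f j)) -> homs t (\sum_(j <- r) f j).
Proof.
move=> hf; rewrite big_seq; elim/big_rec: _ => [|j z /hf hj hz]; first exact: homs0.
exact: homsD.
Qed.

Lemma homs_linear (f : {linear freealg G -> freealg G}) s t z :
  (forall w, perm_eq w s -> homs t (f (mon w))) -> homs s z -> homs t (f z).
Proof.
move=> fh hz; rewrite (linear_malg_sum _ (linear_fun f)).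
by apply: homs_sum => w /hz ws; apply: homsZ; rewrite monE; apply: fh.
Qed.

Lemma homs_genl g t z : homs t z -> homs (g :: t) (gen g * z).
Proof.
move=> hz; rewrite [z]malg_sum mulr_sumr; apply: homs_sum => w /hz wt.
by rewrite -malg_scalerAr monE -mon_cons; apply/homsZ/homs_mon; rewrite perm_cons.
Qed.

Lemma homs_genr g t z : homs t z -> homs (g :: t) (z * gen g).
Proof.
move=> hz; rewrite [z]malg_sum mulr_suml; apply: homs_sum => w /hz wt.
rewrite -scalerAl monE genE monM; apply/homsZ/homs_mon.
by rewrite cats1 perm_rcons perm_cons.
Qed.

Lemma eq_linear_homs (V : lmodType Qq) (f h : freealg G -> V) t z :
  linear f -> linear h -> (forall w, perm_eq w t -> f (mon w) = h (mon w)) ->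
  homs t z -> f z = h z.
Proof.
move=> lf lh fh hz; apply: eq_linear_supp => // w /hz wt.
by rewrite monE fh.
Qed.

Lemma eq_linear_mon (V : lmodType Qq) (f h : freealg G -> V) :
  linear f -> linear h -> (forall w, f (mon w) = h (mon w)) -> f =1 h.
Proof. by move=> lf lh fh; apply: eq_linear => // w; rewrite monE fh. Qed.

End Words.

Section Letters.
Variable D : datum.
Local Notation L := (Iinf D).
Implicit Types (x y : L) (s t : seq L).

Definition wpar s : bool := \big[addb/false]_(g <- s) par g.
Definition wwt x s : int := \sum_(y <- s) wpair x y.

Lemma wpar_cons x s : wpar (x :: s) = par x (+) wpar s.
Proof. by rewrite /wpar big_cons. Qed.

Lemma wwt_cons x y s : wwt x (y :: s) = wpair x y + wwt x s.
Proof. by rewrite /wwt big_cons. Qed.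

Lemma perm_wpar s t : perm_eq s t -> wpar s = wpar t.
Proof. exact: perm_big. Qed.

Lemma perm_wwt x s t : perm_eq s t -> wwt x s = wwt x t.
Proof. exact: perm_big. Qed.

Lemma wpairC x y : wpair x y = wpair y x.
Proof.
rewrite /wpair [(lv x)%:Z * _]mulrC; congr (_ * _).
by case: (D) x y => *.
Qed.

End Letters.

(** The left and right skew derivations of the free algebra by the letter [x]. The
recursion is the skew Leibniz rule for a first letter [y]; that they are components
of the coproduct is [lext_rho_left] and [lext_rho_right]. *)
Fixpoint dlw (D : datum) (x : Iinf D) (s : seq (Iinf D)) : freealg (Iinf D) :=
  if s is y :: s' then
    (x == y)%:R *: mon s'
    + (sgn (par x && par y) * q ^ wpair x y) *: (gen y * dlw x s')
  else 0.

Fixpoint drw (D : datum) (x : Iinf D) (s : seq (Iinf D)) : freealg (Iinf D) :=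
  if s is y :: s' then
    gen y * drw x s'
    + ((x == y)%:R * (sgn (par x && wpar s') * q ^ wwt x s')) *: mon s'
  else 0.

HB.lock Definition dl (D : datum) (x : Iinf D) : freealg (Iinf D) -> freealg (Iinf D) :=
  lext (fun w : {fmonom Iinf D} => dlw x w).
HB.lock Definition dr (D : datum) (x : Iinf D) : freealg (Iinf D) -> freealg (Iinf D) :=
  lext (fun w : {fmonom Iinf D} => drw x w).

Section Derivations.
Variable D : datum.
Local Notation L := (Iinf D).
Local Notation F := (freealg L).
Local Notation W := {fmonom L}.
Local Notation FF := {malg Qq[(W * W)%type]}.
Implicit Types (x y : L) (s t : seq L) (z : F).

Lemma dl_linear x : linear (dl x).
Proof. by rewrite dl.unlock; exact: lext_is_linear. Qed.

Lemma dr_linear x : linear (dr x).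
Proof. by rewrite dr.unlock; exact: lext_is_linear. Qed.

HB.instance Definition _ x := GRing.isLinear.Build Qq F F *:%R (dl x) (dl_linear x).
HB.instance Definition _ x := GRing.isLinear.Build Qq F F *:%R (dr x) (dr_linear x).

Lemma dlE x s : dl x (mon s) = dlw x s.
Proof. by rewrite dl.unlock lext_mon. Qed.

Lemma drE x s : dr x (mon s) = drw x s.
Proof. by rewrite dr.unlock lext_mon. Qed.

Lemma dl_1 x : dl x (mon [::]) = 0. Proof. by rewrite dlE. Qed.
Lemma dr_1 x : dr x (mon [::]) = 0. Proof. by rewrite drE. Qed.

Lemma dl_cons x y s : dl x (mon (y :: s)) = (x == y)%:R *: mon s
  + (sgn (par x && par y) * q ^ wpair x y) *: (gen y * dl x (mon s)).
Proof. by rewrite !dlE. Qed.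

Lemma dr_cons x y s : dr x (mon (y :: s)) = gen y * dr x (mon s)
  + ((x == y)%:R * (sgn (par x && wpar s) * q ^ wwt x s)) *: mon s.
Proof. by rewrite !drE. Qed.

Lemma dlw_notin x s : x \notin s -> dlw x s = 0.
Proof.
elim: s => //= y s IH; rewrite inE negb_or => /andP[/negPf-> /IH->].
by rewrite scale0r mulr0 scaler0 addr0.
Qed.

Lemma drw_notin x s : x \notin s -> drw x s = 0.
Proof.
elim: s => //= y s IH; rewrite inE negb_or => /andP[/negPf-> /IH->].
by rewrite mul0r scale0r mulr0 addr0.
Qed.

Lemma perm_tail x y s t : perm_eq (y :: s) (x :: t) -> x \in s ->
  perm_eq (y :: rem x s) t.
Proof.
move=> st xs; rewrite -(perm_cons x); apply: perm_trans _ st.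
rewrite -[x :: y :: _]/([:: x] ++ [:: y] ++ _) perm_catCA /= perm_cons perm_sym.
exact: perm_to_rem.
Qed.

Lemma homs_dlw x s t : perm_eq s (x :: t) -> homs t (dlw x s).
Proof.
elim: s t => [|y s IH] t /= st; first exact: homs0.
apply: homsD.
  case: eqP => [xy|_]; last by rewrite scale0r; apply: homs0.
  by apply/homsZ/homs_mon; move: st; rewrite xy perm_cons.
apply: homsZ; have [xs|/dlw_notin->] := boolP (x \in s); last first.
  by rewrite mulr0; apply: homs0.
apply: homs_perm (perm_tail st xs) _; apply/homs_genl/IH; exact: perm_to_rem.
Qed.

Lemma homs_drw x s t : perm_eq s (x :: t) -> homs t (drw x s).
Proof.
elim: s t => [|y s IH] t /= st; first exact: homs0.
apply: homsD.
  have [xs|/drw_notin->] := boolP (x \in s); last first.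
    by rewrite mulr0; apply: homs0.
  apply: homs_perm (perm_tail st xs) _; apply/homs_genl/IH; exact: perm_to_rem.
case: eqP => [xy|_]; last by rewrite mul0r scale0r; apply: homs0.
by apply/homsZ/homs_mon; move: st; rewrite xy perm_cons.
Qed.

Lemma homs_dl x t z : homs (x :: t) z -> homs t (dl x z).
Proof. by apply: (homs_linear (f := dl x)) => w /homs_dlw /=; rewrite dlE. Qed.

Lemma homs_dr x t z : homs (x :: t) z -> homs t (dr x z).
Proof. by apply: (homs_linear (f := dr x)) => w /homs_drw /=; rewrite drE. Qed.

Lemma dl_notin x t z : x \notin t -> homs t z -> dl x z = 0.
Proof.
move=> xt; apply: (eq_linear_homs (linear_fun _) (linear_fun \0)) => w wt.
by rewrite /= dlE dlw_notin // (perm_mem wt).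
Qed.

Lemma dr_notin x t z : x \notin t -> homs t z -> dr x z = 0.
Proof.
move=> xt; apply: (eq_linear_homs (linear_fun _) (linear_fun \0)) => w wt.
by rewrite /= drE drw_notin // (perm_mem wt).
Qed.

Section Form.
Variables (B : F -> F -> Qq) (hB : is_form B).

Lemma lin_formr (u : F) : linear (B u : F -> Qq^o).
Proof. exact: form_linr hB u. Qed.

Lemma lin_forml (u : F) : linear (B^~ u : F -> Qq^o).
Proof. exact: form_linl hB u. Qed.

Lemma tmulE (s t : FF) : tmul s t =
  lext (fun u : W * W => lext (fun v : W * W => (sgn (wpar u.2 && wpar v.1)
         * q ^ word_pair u.2 v.1) *: << (mmul u.1 v.1, mmul u.2 v.2) >>) t) s.
Proof.
rewrite /tmul /lext; apply: eq_bigr => u _; rewrite scaler_sumr.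
by apply: eq_bigr => v _; rewrite !scalerA mulrA scale_malgU.
Qed.

Lemma tens_mon (u v : W) : tens << u >> << v >> = << (u, v) >>.
Proof.
by rewrite /tens !msuppU !oner_eq0 !big_seq_fset1 !mcoeffUU mulr1.
Qed.

Lemma tens_mon2 s t : tens (mon s) (mon t) = << (FMonom s, FMonom t) >>.
Proof. by rewrite !mon.unlock tens_mon. Qed.

Lemma rho_mon s : rho (mon s) = rho_word (FMonom s).
Proof. exact: lext_mon. Qed.

Lemma FMonomM s t : mmul (FMonom s) (FMonom t) = FMonom (s ++ t).
Proof. by apply/eqP; rewrite fmP fmM. Qed.

Lemma rho_genE x : rho_gen x =
  << (FMonom [:: x], FMonom [::]) >> + << (FMonom [::], FMonom [:: x]) >>.
Proof.
rewrite /rho_gen.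
have <- : mon [::] = 1 := @mon0 L.
by rewrite genE; congr (_ + _); exact: tens_mon2.
Qed.

Lemma lext_rho_gen (V : lmodType Qq) (h : W * W -> V) x :
  lext h (rho_gen x)
  = h (FMonom [:: x], FMonom [::]) + h (FMonom [::], FMonom [:: x]).
Proof. by rewrite rho_genE lextD; congr (_ + _); exact: lextU. Qed.

Lemma wpar0 : wpar ([::] : seq L) = false.
Proof. by rewrite /wpar big_nil. Qed.

(** Multiplication by the two terms of the coproduct of a generator: only the
second one has to pass the left factor, at the cost of a sign and a power of [q]. *)
Lemma rho_word_cons x s : rho_word (FMonom (x :: s)) =
  lext (fun v : W * W => << (FMonom (x :: v.1), v.2) >>) (rho_word (FMonom s))
  + lext (fun v : W * W => (sgn (par x && wpar v.1) * q ^ wwt x v.1)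
                    *: << (v.1, FMonom (x :: v.2)) >>) (rho_word (FMonom s)).
Proof.
transitivity (tmul (rho_gen x) (rho_word (FMonom s))); first by [].
rewrite tmulE lext_rho_gen; apply: congr2; apply: eq_lext => -[[u] [v]] /=.
  rewrite wpar0 /word_pair /= big_nil expr0z mulr1 /sgn expr0 scale1r.
  by rewrite !FMonomM.
by rewrite wpar_cons wpar0 addbF /word_pair big_seq1 !FMonomM.
Qed.

Lemma lext_rho_cons (V : lmodType Qq) (p : W * W -> V) x s :
  lext p (rho_word (FMonom (x :: s))) =
  lext (fun v : W * W => p (FMonom (x :: v.1), v.2)) (rho_word (FMonom s))
  + lext (fun v : W * W => (sgn (par x && wpar v.1) * q ^ wwt x v.1)
                    *: p (v.1, FMonom (x :: v.2))) (rho_word (FMonom s)).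
Proof.
rewrite rho_word_cons lextD; apply: congr2.
  rewrite (linear_lext _ _ (lext_is_linear p)).
  by apply: eq_lext => v; rewrite lextU.
rewrite (linear_lext _ _ (lext_is_linear p)).
by apply: eq_lext => v; rewrite lextZ lextU.
Qed.

Lemma lext_rho_nil (V : lmodType Qq) (p : W * W -> V) :
  lext p (rho_word (FMonom [::] : W)) = p (FMonom [::], FMonom [::]).
Proof. by rewrite /rho_word /= -mon0 tens_mon2 lextU. Qed.

Lemma wwt0 x : wwt x [::] = 0.
Proof. by rewrite /wwt big_nil. Qed.

Lemma linear_genl x : linear (fun z : F => gen x * z).
Proof. by move=> c y z; rewrite mulrDr malg_scalerAr. Qed.

Lemma eq_FMonom s t : (FMonom s == FMonom t :> W) = (s == t).
Proof. by rewrite fmP. Qed.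

(** Counit property: the component of the coproduct with trivial left factor. *)
Lemma lext_rho_left1 s :
  lext (fun v : W * W => (v.1 == FMonom [::])%:R *: << v.2 >>)
       (rho_word (FMonom s)) = mon s.
Proof.
elim: s => [|x s IH]; first by rewrite lext_rho_nil eqxx scale1r monE.
rewrite lext_rho_cons mon_cons -IH (linear_lext _ _ (linear_genl x)) -[RHS]add0r.
apply: congr2.
  by rewrite /lext big1 // => -[[u] [v]] _ /=; rewrite ?eq_FMonom !(scale0r, scaler0).
apply: eq_lext => -[[u] [v]] /=; rewrite !eq_FMonom -malg_scalerAr.
case: eqP => [->|_]; last by rewrite !scale0r scaler0.
by rewrite wpar0 andbF wwt0 expr0z mulr1 !scale1r !monE /= mon_cons.
Qed.

Lemma lext_rho_right1 s :
  lext (fun v : W * W => (v.2 == FMonom [::])%:R *: << v.1 >>)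
       (rho_word (FMonom s)) = mon s.
Proof.
elim: s => [|x s IH]; first by rewrite lext_rho_nil eqxx scale1r monE.
rewrite lext_rho_cons mon_cons -IH (linear_lext _ _ (linear_genl x)) -[RHS]addr0.
apply: congr2.
  by apply: eq_lext => -[[u] [v]] /=; rewrite -malg_scalerAr !monE /= mon_cons.
by rewrite /lext big1 // => -[[u] [v]] _ /=; rewrite ?eq_FMonom !(scale0r, scaler0).
Qed.

Lemma lext_rho_left x s :
  lext (fun v : W * W => (v.1 == FMonom [:: x])%:R *: << v.2 >>)
       (rho_word (FMonom s)) = dlw x s.
Proof.
elim: s => [|y s IH]; first by rewrite lext_rho_nil eq_FMonom scale0r.
rewrite lext_rho_cons /= -IH -(lext_rho_left1 s); apply: congr2.
  rewrite (linear_lext _ _ (linear_scale _ (@linear_id F))).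
  apply: eq_lext => -[[u] [v]] /=; rewrite !eq_FMonom eqseq_cons.
  by rewrite scalerA -natrM mulnb [y == x]eq_sym.
rewrite (linear_lext _ _ (linear_scale _ (linear_genl y))).
apply: eq_lext => -[[u] [v]] /=; rewrite -malg_scalerAr !eq_FMonom.
case: eqP => [->|_]; last by rewrite !scale0r !scaler0.
rewrite !scale1r !monE /= mon_cons wpar_cons wpar0 wwt_cons wwt0 addbF addr0.
by rewrite andbC wpairC.
Qed.

Lemma lext_rho_right x s :
  lext (fun v : W * W => (v.2 == FMonom [:: x])%:R *: << v.1 >>)
       (rho_word (FMonom s)) = drw x s.
Proof.
elim: s => [|y s IH]; first by rewrite lext_rho_nil eq_FMonom scale0r.
rewrite lext_rho_cons /= -IH; apply: congr2.
  rewrite (linear_lext _ _ (linear_genl y)).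
  apply: eq_lext => -[[u] [v]] /=; rewrite -malg_scalerAr !eq_FMonom.
  by rewrite !monE /= mon_cons.
have [<-|yx] := eqVneq x y; last first.
  rewrite mul0r scale0r /lext big1 // => -[[u] [v]] _ /=.
  by rewrite eq_FMonom eqseq_cons eq_sym (negPf yx) scale0r !scaler0.
(* The new letter [x] as right factor has passed the whole word [s]; [Phi] records
   the resulting scalar, which depends only on that word. *)
pose Phi : F -> F :=
  lext (fun w : W => (sgn (par x && wpar w) * q ^ wwt x w) *: << w >>).
have PhiE u : Phi (mon u) = (sgn (par x && wpar u) * q ^ wwt x u) *: mon u.
  by rewrite /Phi lext_mon monE.
rewrite mul1r -PhiE -(lext_rho_right1 s) /Phi.
rewrite (linear_lext _ _ (lext_is_linear _)); apply: eq_lext => -[[u] [v]] /=.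
by rewrite !eq_FMonom eqseq_cons eqxx /= lextZ lextU !scalerA mulrC.
Qed.

Lemma form_rho s t u : B (mon s) (mon t * mon u) =
  lext (fun k : W * W => B << k.1 >> (mon t) * B << k.2 >> (mon u) : Qq^o)
       (rho_word (FMonom s)).
Proof.
rewrite (form_mulr hB) rho_mon tens_mon2 /tform /lext; apply: eq_bigr => k _.
by rewrite msuppU oner_eq0 big_seq_fset1 mcoeffUU mulr1 !monE.
Qed.

Lemma form_scaler u (c : Qq) (z : F) : B u (c *: z) = c * B u z.
Proof.
have B0 : B u 0 = 0.
  have /= := form_linr hB u 1 0 0; rewrite scale1r addr0 mul1r => B2.
  by apply: (@addrI _ (B u 0)); rewrite addr0 -B2.
by rewrite -[c *: z]addr0 (form_linr hB) B0 addr0.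
Qed.

Lemma form_mon00 : B (mon [::]) (mon [::]) = 1.
Proof. by rewrite !mon0 (form_11 hB). Qed.

Lemma form_1gen x : B (mon [::]) (mon [:: x]) = 0.
Proof.
rewrite (form_sym hB); apply: (@addrI _ (B (mon [:: x]) (mon [::]))).
have E : mon [::] * mon [::] = mon [::] :> F by rewrite monM.
rewrite addr0 -[in RHS]E {E}.
rewrite form_rho lext_rho_cons !lext_rho_nil /= !monE /= form_mon00 mulr1 mul1r.
by rewrite wpar0 andbF wwt0 expr0z mulr1 scale1r.
Qed.

Lemma form_1mon s : B (mon [::]) (mon s) = (s == [::])%:R.
Proof.
case: s => [|x s]; first by rewrite form_mon00.
by rewrite -cat1s -monM form_rho lext_rho_nil /= !monE /= form_1gen mul0r.
Qed.

Lemma form_genmon x s : B (mon [:: x]) (mon s) = (s == [:: x])%:R / gden x.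
Proof.
case: s => [|y [|z s]].
- by rewrite (form_sym hB) form_1gen mul0r.
- by rewrite -!genE (form_gen hB) eqseq_cons andbT eq_sym.
rewrite -(cat1s y) -monM form_rho lext_rho_cons !lext_rho_nil /= !monE /=.
by rewrite (form_1gen y) (form_1mon (z :: s)) mulr0 mul0r scaler0 addr0 eqseq_cons andbF mul0r.
Qed.

(** Only the component of the coproduct whose left factor is the generator [x]
pairs nontrivially with [gen x]. *)
Lemma form_genl x (y z : F) : B (gen x * y) z = (gden x)^-1 * B y (dl x z).
Proof.
suff /(_ y) : (fun y : F => B (gen x * y) z : Qq^o)
    =1 (fun y : F => (gden x)^-1 * B y (dl x z) : Qq^o) by [].
apply: eq_linear_mon => [c u v|c u v|u].
- by rewrite mulrDr -malg_scalerAr (lin_forml z).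
- by rewrite (lin_forml (dl x z)) mulrDr scalerAr.
suff /(_ z) : (fun z : F => B (gen x * mon u) z : Qq^o)
    =1 (fun z : F => (gden x)^-1 * B (mon u) (dl x z) : Qq^o) by [].
apply: eq_linear_mon => [||s].
- exact: lin_formr.
- by move=> c v w; rewrite linearP (lin_formr (mon u)) mulrDr scalerAr.
rewrite (form_sym hB) genE form_rho dlE -lext_rho_left.
rewrite (@linear_lext _ F Qq^o (fun z => (gden x)^-1 * B (mon u) z) _ _
           (linear_scale (gden x)^-1 (lin_formr (mon u)))).
apply: eq_lext => -[[v] [w]] /=; rewrite !monE /= form_scaler [in LHS](form_sym hB).
by rewrite form_genmon eq_FMonom (form_sym hB (mon w)) [_ / _]mulrC -mulrA.
Qed.

Lemma form_genr x (y z : F) : B (y * gen x) z = (gden x)^-1 * B y (dr x z).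
Proof.
suff /(_ y) : (fun y : F => B (y * gen x) z : Qq^o)
    =1 (fun y : F => (gden x)^-1 * B y (dr x z) : Qq^o) by [].
apply: eq_linear_mon => [c u v|c u v|u].
- by rewrite mulrDl -scalerAl (lin_forml z).
- by rewrite (lin_forml (dr x z)) mulrDr scalerAr.
suff /(_ z) : (fun z : F => B (mon u * gen x) z : Qq^o)
    =1 (fun z : F => (gden x)^-1 * B (mon u) (dr x z) : Qq^o) by [].
apply: eq_linear_mon => [||s].
- exact: lin_formr.
- by move=> c v w; rewrite linearP (lin_formr (mon u)) mulrDr scalerAr.
rewrite (form_sym hB) genE form_rho drE -lext_rho_right.
rewrite (@linear_lext _ F Qq^o (fun z => (gden x)^-1 * B (mon u) z) _ _
           (linear_scale (gden x)^-1 (lin_formr (mon u)))).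
apply: eq_lext => -[[v] [w]] /=; rewrite !monE /= form_scaler.
rewrite (form_sym hB (mon w)) form_genmon eq_FMonom (form_sym hB (mon v)).
by rewrite mulrC [_ / _]mulrC -mulrA.
Qed.

(** Removing the first letter of [s] by [form_genl] removes the same letter from
[z], or gives zero if it does not occur there. *)
Lemma form_orth s t z : homs t z -> ~~ perm_eq s t -> B (mon s) z = 0.
Proof.
elim: s t z => [|x s IH] t z hz st.
  rewrite (@eq_linear_homs _ Qq^o (B (mon [::])) (fun=> 0) t z) //.
  - exact: lin_formr.
  - by move=> c u v; rewrite scaler0 addr0.
  move=> w wt; rewrite form_1mon; case: eqP => // w0.
  by move: wt; rewrite w0 (negPf st).
rewrite mon_cons form_genl; have [xt|xt] := boolP (x \in t); last first.
  by rewrite (dl_notin xt hz) -(scale0r 0) form_scaler mul0r mulr0.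
rewrite (IH (rem x t)) ?mulr0 //.
  by apply: homs_dl; apply: homs_perm hz; apply: perm_to_rem.
apply: contra st => st; rewrite (perm_trans _ (_ : perm_eq (x :: rem x t) t)) ?perm_cons //.
by rewrite perm_sym perm_to_rem.
Qed.

End Form.
End Derivations.

(** * Commutation relations in the quantum group *)

(** Extensionality of morphisms needs proof irrelevance for the additivity proof
that they carry. *)
Lemma Pdual_eq (P : zmodType) (g h : Pdual P) :
  (forall x : P, (g : {additive P -> int}) x = (h : {additive P -> int}) x) ->
  g = h.
Proof.
case: g h => [g [[cg]]] [h [[ch]]] /= /funext gh; subst h.
by have -> : cg = ch by exact: Prop_irrelevance.
Qed.

Lemma coroot_alpha (D : datum) (i j : idx D) : coroot i (alpha j) = cartan i j.
Proof. by case: (D) i j. Qed.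

Section QuantumGroup.
Variables (D : datum) (U : algType Qq) (pi : {lrmorphism freealg (Ugen D) -> U}).
Hypothesis hpi : presents pi.
Local Notation L := (Iinf D).
Local Notation ua := (ua pi).
Local Notation ub := (ub pi).
Local Notation uq := (uq pi).
Local Notation uK := (uK pi).
Local Notation uKV := (uKV pi).
Implicit Types (x y : L).

Lemma pi_relator r : Urelator r -> pi r = 0.
Proof. by move=> rr; apply/(proj2 hpi)/Ideal_gen. Qed.

Lemma uq0 : uq (\0 : {additive wlat D -> int}) = 1.
Proof.
by apply/eqP; rewrite -subr_eq0 -(rmorph1 pi) -rmorphB; apply/eqP/pi_relator/Urel_q0.
Qed.

Lemma uqD (h h' : Pdual (wlat D)) :
  uq h * uq h' = uq (h \+ h' : {additive wlat D -> int}).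
Proof.
by apply/eqP; rewrite -subr_eq0 -rmorphM -rmorphB; apply/eqP/pi_relator/Urel_qD.
Qed.

Lemma uqNK (h : Pdual (wlat D)) : uq (\- h : {additive wlat D -> int}) * uq h = 1.
Proof.
rewrite uqD -uq0; congr uq; apply: Pdual_eq => v /=.
by rewrite addNr.
Qed.

Lemma uq_a (h : Pdual (wlat D)) x :
  uq h * ua x = q ^ ((lv x)%:Z * h (alpha (ix x))) *: (ua x * uq h).
Proof.
have /eqP := pi_relator (Urel_qa h x).
rewrite rmorphB /= !rmorphM linearZ subr_eq0 => /eqP /= E.
by rewrite -[LHS]mulr1 -(uqNK h) mulrA E scalerAl.
Qed.

Lemma uq_b (h : Pdual (wlat D)) x :
  uq h * ub x = q ^ (- ((lv x)%:Z * h (alpha (ix x)))) *: (ub x * uq h).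
Proof.
have /eqP := pi_relator (Urel_qb h x).
rewrite rmorphB /= !rmorphM linearZ subr_eq0 => /eqP /= E.
by rewrite -[LHS]mulr1 -(uqNK h) mulrA E scalerAl.
Qed.

Lemma piM u v : pi (u * v) = pi u * pi v.
Proof. exact: rmorphM. Qed.

Lemma piB u v : pi (u - v) = pi u - pi v.
Proof. exact: linearB. Qed.

Lemma piZ (c : Qq) u : pi (c *: u) = c *: pi u.
Proof. exact: linearZZ. Qed.

Lemma pi_scomm u v p p' :
  pi (scomm u v p p') = pi u * pi v - sgn (p && p') *: (pi v * pi u).
Proof. by rewrite -(piM u v) -(piM v u) -piZ -piB. Qed.

(** The mixed relation, solved for the product in the other order. *)
Lemma a_b x y : ua x * ub y = sgn (par x && par y) *: (ub y * ua x)
  + ((x == y)%:R / gden x) *: (uK x - uKV x).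
Proof.
have E := pi_relator (Urel_ab x y).
apply/eqP; rewrite addrC -subr_eq -subr_eq0; apply/eqP; rewrite -[RHS]E.
by rewrite piB pi_scomm piZ piB.
Qed.

Lemma KV_eq x : uKV x = uq (\- (dcoroot (lv x)%:Z (ix x)) : {additive wlat D -> int}).
Proof. by congr uq; apply: Pdual_eq => v /=; rewrite mulNr mulNr. Qed.

Lemma KVK x : uKV x * uK x = 1.
Proof. by rewrite KV_eq uqNK. Qed.

Lemma KKV x : uK x * uKV x = 1.
Proof.
rewrite KV_eq uqD -uq0; congr uq; apply: Pdual_eq => v /=.
by rewrite addrN.
Qed.

Lemma dcoroot_wpair x y :
  (lv y)%:Z * dcoroot (lv x)%:Z (ix x) (alpha (ix y)) = wpair x y.
Proof. by rewrite /= coroot_alpha /wpair -!mulrA mulrCA. Qed.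

Lemma K_a x y : uK x * ua y = q ^ wpair x y *: (ua y * uK x).
Proof. by rewrite uq_a dcoroot_wpair. Qed.

Lemma K_b x y : uK x * ub y = q ^ (- wpair x y) *: (ub y * uK x).
Proof. by rewrite uq_b dcoroot_wpair. Qed.

End QuantumGroup.

(** * The derivations as commutators *)

Lemma q_neq0 : q != 0.
Proof. by rewrite tofrac_eq0 polyX_eq0. Qed.

Lemma qzK (n : int) (V : lmodType Qq) (v : V) : q ^ n *: (q ^ (- n) *: v) = v.
Proof. by rewrite scalerA -expfzDr ?q_neq0 // subrr expr0z scale1r. Qed.

Lemma sgn_mul (c d : bool) : sgn c * sgn d = sgn (c (+) d).
Proof. by rewrite /sgn signr_addb. Qed.

Section Evaluation.
Variables (G : choiceType) (U : algType Qq) (f : G -> U).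

Lemma freeval_linear : linear (freeval f).
Proof. exact: lext_is_linear. Qed.

HB.instance Definition _ :=
  GRing.isLinear.Build Qq (freealg G) U *:%R (freeval f) freeval_linear.

Lemma freeval_mon s : freeval f (mon s) = \prod_(g <- s) f g.
Proof. exact: lext_mon. Qed.

Lemma freeval_1 : freeval f (mon [::]) = 1.
Proof. by rewrite freeval_mon big_nil. Qed.

Lemma freeval_genl g z : freeval f (gen g * z) = f g * freeval f z.
Proof.
apply: (eq_linear_mon (f := fun z => freeval f (gen g * z))
                      (h := fun z => f g * freeval f z)).
- by move=> c u v; rewrite mulrDr -malg_scalerAr linearP.
- by lin.
by move=> s; rewrite -mon_cons !freeval_mon big_cons.
Qed.

Lemma freeval_genr g z : freeval f (z * gen g) = freeval f z * f g.
Proof.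
apply: (eq_linear_mon (f := fun z => freeval f (z * gen g))
                      (h := fun z => freeval f z * f g)).
- by move=> c u v; rewrite mulrDl -scalerAl linearP.
- by lin.
by move=> s; rewrite genE monM !freeval_mon big_cat big_seq1.
Qed.

Lemma freevalD y z : freeval f (y + z) = freeval f y + freeval f z.
Proof. exact: linearD. Qed.

Lemma freevalZ c z : freeval f (c *: z) = c *: freeval f z.
Proof. exact: linearZ. Qed.

End Evaluation.

Lemma freeval_dl (D : datum) (U : algType Qq) (f : Iinf D -> U) x y s :
  freeval f (dl x (mon (y :: s))) = (x == y)%:R *: freeval f (mon s)
    + (sgn (par x && par y) * q ^ wpair x y) *: (f y * freeval f (dl x (mon s))).
Proof.
rewrite dl_cons freevalD; apply: congr2; first exact: freevalZ.
by rewrite freevalZ freeval_genl.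
Qed.

Lemma freeval_dr (D : datum) (U : algType Qq) (f : Iinf D -> U) x y s :
  freeval f (dr x (mon (y :: s))) = f y * freeval f (dr x (mon s))
    + ((x == y)%:R * (sgn (par x && wpar s) * q ^ wwt x s)) *: freeval f (mon s).
Proof.
rewrite dr_cons freevalD; apply: congr2; last exact: freevalZ.
exact: freeval_genl.
Qed.

(** The relations between the generators on which the commutation formulas rest,
for arbitrary families of elements of an algebra; [KV x] is the inverse of [K x]. *)
Record double_relations (D : datum) (U : algType Qq) (a b K KV : Iinf D -> U) :
    Prop := DoubleRelations {
  rel_KVK : forall x, KV x * K x = 1;
  rel_KKV : forall x, K x * KV x = 1;
  rel_K_a : forall x y, K x * a y = q ^ wpair x y *: (a y * K x);
  rel_K_b : forall x y, K x * b y = q ^ (- wpair x y) *: (b y * K x);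
  rel_a_b : forall x y, a x * b y = sgn (par x && par y) *: (b y * a x)
    + ((x == y)%:R / gden x) *: (K x - KV x)
}.

(** [hom e] stands for the homogeneous elements of parity [e]. *)
Record antipode_relations (D : datum) (U : algType Qq) (a b K KV : Iinf D -> U)
    (S : U -> U) (hom : bool -> U -> Prop) : Prop := AntipodeRelations {
  rel_S_mul : forall e e' u v, hom e u -> hom e' v ->
    S (u * v) = sgn (e && e') *: (S v * S u);
  rel_hom_a : forall x, hom (par x) (a x);
  rel_hom_N : forall s, hom (wpar s) (freeval b (mon s));
  rel_hom_K : forall x, hom false (K x);
  rel_hom_KV : forall x, hom false (KV x);
  rel_S_a : forall x, S (a x) = - (KV x * a x);
  rel_S_b : forall x, S (b x) = - (b x * K x);
  rel_S_K : forall x, S (K x) = KV x;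
  rel_S_KV : forall x, S (KV x) = K x
}.

Section Commutation.
Variables (D : datum) (U : algType Qq).
Local Notation L := (Iinf D).
Local Notation F := (freealg L).
Local Notation W := {fmonom L}.
Implicit Types (x y : L) (s t : seq L) (z : F).
Variables (a b K KV : L -> U).
Hypothesis rel : double_relations a b K KV.
Let KVK := rel_KVK rel.
Let KKV := rel_KKV rel.
Let K_a := rel_K_a rel.
Let K_b := rel_K_b rel.
Let a_b := rel_a_b rel.
Local Notation P := (freeval a).
Local Notation N := (freeval b).

Lemma a_KV x y : a y * KV x = q ^ wpair x y *: (KV x * a y).
Proof.
rewrite -[LHS]mul1r -(KVK x) -!mulrA [K x * _]mulrA K_a -!scalerAl -!scalerAr.
by rewrite -!mulrA KKV mulr1.
Qed.

Lemma b_K x y : b y * K x = q ^ wpair x y *: (K x * b y).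
Proof. by rewrite K_b qzK. Qed.

Lemma KV_b x y : KV x * b y = q ^ wpair x y *: (b y * KV x).
Proof.
rewrite -[RHS]mul1r -(KVK x) -!mulrA -scalerAr [K x * _]mulrA K_b.
by rewrite -!scalerAl !scalerAr qzK -!mulrA KKV mulr1.
Qed.

Lemma K_P x s : K x * P (mon s) = q ^ wwt x s *: (P (mon s) * K x).
Proof.
elim: s => [|y s IH]; first by rewrite freeval_1 wwt0 expr0z scale1r mulr1 mul1r.
rewrite mon_cons freeval_genl mulrA K_a wwt_cons expfzDr ?q_neq0 //.
by rewrite -scalerAl -[a y * K x * _]mulrA IH -scalerAr scalerA mulrA.
Qed.

Lemma KV_N x s : KV x * N (mon s) = q ^ wwt x s *: (N (mon s) * KV x).
Proof.
elim: s => [|y s IH]; first by rewrite freeval_1 wwt0 expr0z scale1r mulr1 mul1r.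
rewrite mon_cons freeval_genl mulrA KV_b wwt_cons expfzDr ?q_neq0 //.
by rewrite -scalerAl -[b y * KV x * _]mulrA IH -scalerAr scalerA mulrA.
Qed.

(** The five terms of the commutation formulas below, in the orders in which the
two sides of the induction step produce them. *)
Lemma shuffle5 (V : zmodType) (t1 t2 t3 t4 t5 : V) :
  t1 + (t2 + t3) + (t4 + t5) = t1 + ((t4 + t2) + (t3 + t5)).
Proof. by rewrite -addrA [t4 + t2]addrC addrACA. Qed.

(** Commuting a positive generator past a word in the negative ones produces
its two skew derivatives, one for each of the two terms of the commutator of the
generators: [K x] is moved to the left of the word and [KV x] to its right. The
parity [wpar s (+) par x] is that of [s] with one letter [x] removed. *)
Lemma a_N x s : a x * N (mon s) = sgn (par x && wpar s) *: (N (mon s) * a x)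
  + (gden x)^-1 *: (K x * N (dl x (mon s))
      - sgn (par x && (wpar s (+) par x)) *: (N (dr x (mon s)) * KV x)).
Proof.
elim: s => [|y s IH].
  rewrite dl_1 dr_1 !linear0 mulr0 mul0r scaler0 subrr scaler0 addr0 freeval_1 wpar0.
  by rewrite andbF /sgn expr0 scale1r mulr1 mul1r.
rewrite freeval_dl freeval_dr mon_cons freeval_genl mulrA a_b mulrDl -!scalerAl.
rewrite -[b y * a x * _]mulrA IH.
rewrite mulrDr -scalerAr -scalerAr mulrBr -scalerAr !scalerDr.
have {IH} Kl : b y * (K x * N (dl x (mon s))) =
    q ^ wpair x y *: (K x * (b y * N (dl x (mon s)))) by rewrite mulrA b_K -scalerAl mulrA.
have KVm := KV_N x s; rewrite Kl mulrBl KVm {Kl KVm} mulrDr mulrDl.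
rewrite -!scalerAr -!scalerAl -!mulrA.
(* The same five elements now occur on both sides; their scalars remain to be
   compared. *)
move: (N (mon s) * a x) (N (dl x _)) (N (dr x _) * KV x) (N (mon s)).
move=> m1 l r m2; rewrite wpar_cons.
rewrite !(scalerDr, scalerN, opprD, scalerA) -shuffle5.
apply: congr2; [apply: congr2; [|apply: congr2] | apply: congr2];
  try (congr (- _)); congr (_ *: _).
- by rewrite sgn_mul; case: (par x); case: (par y); case: (wpar s).
- by rewrite mulrAC mulrC.
- rewrite mulrAC sgn_mul mulrC; congr (_ * _).
  by case: (par x); case: (par y); case: (wpar s).
- by rewrite mulrC.
- case: eqVneq => [<-|_]; last by rewrite !mul0r !mulr0.
  rewrite !mul1r -mulrA; congr (_ * _); rewrite mulrA sgn_mul.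
  by case: (par x); case: (wpar s); rewrite /sgn /= ?expr0 mul1r.
Qed.

(** The mirror image of [a_N], with the two derivations exchanged. *)
Lemma P_b x s : P (mon s) * b x = sgn (par x && wpar s) *: (b x * P (mon s))
  + (gden x)^-1 *: (P (dr x (mon s)) * K x
      - sgn (par x && (wpar s (+) par x)) *: (KV x * P (dl x (mon s)))).
Proof.
elim: s => [|y s IH].
  rewrite dl_1 dr_1 !linear0 mulr0 mul0r scaler0 subrr scaler0 addr0 freeval_1 wpar0.
  by rewrite andbF /sgn expr0 scale1r mulr1 mul1r.
rewrite freeval_dl freeval_dr mon_cons freeval_genl -[a y * _ * b x]mulrA IH.
rewrite mulrDr -scalerAr -scalerAr [a y * (b x * _)]mulrA a_b mulrBr -scalerAr.
have {IH} Kl : a y * (KV x * P (dl x (mon s))) =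
    q ^ wpair x y *: (KV x * (a y * P (dl x (mon s)))) by rewrite mulrA a_KV -scalerAl mulrA.
rewrite Kl {Kl} mulrDl mulrDr.
have KPm := K_P x s.
rewrite [(_ + _) * K x]mulrDl -!scalerAr -!scalerAl mulrBl -!mulrA.
have -> : ((y == x)%:R / gden y) *: (K y * P (mon s) - KV y * P (mon s)) =
   ((x == y)%:R / gden x) *: (q ^ wwt x s *: (P (mon s) * K x) - KV x * P (mon s)).
  by rewrite eq_sym; case: eqVneq => [<-|_]; rewrite ?mul0r ?scale0r // KPm.
move: (a y * (P (dr x _) * _)) (a y * P (dl x _)) (a y * P (mon s)).
move=> r l m1; move: (P (mon s) * K x) (KV x * P (mon s)) => m2 m3.
rewrite wpar_cons !(scalerDr, scalerN, opprD, scalerA) shuffle5.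
apply: congr2; [|apply: congr2; apply: congr2];
  try (congr (- _)); try (congr (_ *: _)).
- by rewrite sgn_mul; case: (par x); case: (par y); case: (wpar s).
- by case: eqVneq => _; rewrite ?mul0r ?mulr0 ?mul0r // !mul1r mulrA mulrAC mulrC mulrA.
- case: eqVneq => [<-|_]; last by rewrite !mul0r !mulr0.
  rewrite mul1r mulr1 mulrC; congr (_ * _).
  by case: (par x); case: (wpar s).
- rewrite -!mulrA; congr (_ * _); rewrite mulrA sgn_mul; congr (sgn _ * _).
  by case: (par x); case: (par y); case: (wpar s).
Qed.

Lemma P_b_homs x t z : homs t z ->
  P z * b x = sgn (par x && wpar t) *: (b x * P z)
  + (gden x)^-1 *: (P (dr x z) * K x
      - sgn (par x && (wpar t (+) par x)) *: (KV x * P (dl x z))).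
Proof.
apply: (eq_linear_homs (f := fun z => P z * b x)
  (h := fun z => sgn (par x && wpar t) *: (b x * P z)
  + (gden x)^-1 *: (P (dr x z) * K x
      - sgn (par x && (wpar t (+) par x)) *: (KV x * P (dl x z))))).
- by lin.
- by lin.
by move=> s st; rewrite P_b (perm_wpar st).
Qed.

Lemma K_P_homs x t z : homs t z -> K x * P z = q ^ wwt x t *: (P z * K x).
Proof.
apply: (eq_linear_homs (f := fun z => K x * P z)
                       (h := fun z => q ^ wwt x t *: (P z * K x))).
- by lin.
- by lin.
by move=> s st; rewrite K_P (perm_wwt _ st).
Qed.

Section Antipode.
Variables (S : {linear U -> U}) (hom : bool -> U -> Prop).
Hypothesis srel : antipode_relations a b K KV S hom.
Let S_mul := rel_S_mul srel.
Let hom_a := rel_hom_a srel.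
Let hom_N := rel_hom_N srel.
Let hom_K := rel_hom_K srel.
Let hom_KV := rel_hom_KV srel.
Let S_a := rel_S_a srel.
Let S_b := rel_S_b srel.
Let S_K := rel_S_K srel.
Let S_KV := rel_S_KV srel.

Lemma hom_b x : hom (par x) (b x).
Proof.
have := hom_N [:: x]; rewrite freeval_mon big_seq1 wpar_cons.
by rewrite /wpar big_nil addbF.
Qed.

Lemma SKN x z : S (K x * N z) = S (N z) * KV x.
Proof.
apply: (eq_linear_mon (f := fun z => S (K x * N z)) (h := fun z => S (N z) * KV x)).
- by lin.
- by lin.
by move=> s; rewrite (S_mul (hom_K x) (hom_N s)) S_K /sgn expr0 scale1r.
Qed.

Lemma SNKV x z : S (N z * KV x) = K x * S (N z).
Proof.
apply: (eq_linear_mon (f := fun z => S (N z * KV x)) (h := fun z => K x * S (N z))).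
- by lin.
- by lin.
by move=> s; rewrite (S_mul (hom_N s) (hom_KV x)) S_KV andbF /sgn expr0 scale1r.
Qed.

Lemma SKVN x z : S (KV x * N z) = S (N z) * K x.
Proof.
apply: (eq_linear_mon (f := fun z => S (KV x * N z)) (h := fun z => S (N z) * K x)).
- by lin.
- by lin.
by move=> s; rewrite (S_mul (hom_KV x) (hom_N s)) S_KV /sgn expr0 scale1r.
Qed.

Lemma S_genl x t z : homs t z ->
  S (N (gen x * z)) = - (sgn (par x && wpar t) *: (S (N z) * (b x * K x))).
Proof.
apply: (eq_linear_homs (f := fun z => S (N (gen x * z)))
         (h := fun z => - (sgn (par x && wpar t) *: (S (N z) * (b x * K x))))).
- by move=> c u v; rewrite linear_genl !linearP.
- by lin.
move=> s st; rewrite freeval_genl (S_mul (hom_b x) (hom_N s)) S_b (perm_wpar st).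
by rewrite mulrN scalerN.
Qed.

Lemma S_genr x t z : homs t z ->
  S (N (z * gen x)) = - (sgn (par x && wpar t) *: (b x * K x * S (N z))).
Proof.
apply: (eq_linear_homs (f := fun z => S (N (z * gen x)))
         (h := fun z => - (sgn (par x && wpar t) *: (b x * K x * S (N z))))).
- by move=> c u v; rewrite mulrDl -scalerAl !linearP.
- by lin.
move=> s st; rewrite freeval_genr (S_mul (hom_N s) (hom_b x)) S_b (perm_wpar st).
by rewrite mulNr scalerN andbC.
Qed.

Lemma K_SN_homs x t z : homs t z ->
  S (N z) * K x = q ^ wwt x t *: (K x * S (N z)).
Proof.
apply: (eq_linear_homs (f := fun z => S (N z) * K x)
                       (h := fun z => q ^ wwt x t *: (K x * S (N z)))).
- by lin.
- by lin.
by move=> s st; rewrite -SKVN KV_N linearZ /= SNKV (perm_wwt _ st).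
Qed.

Lemma S_lin4 k u c v k' w :
  S (k *: u + c *: (v - k' *: w)) = k *: S u + c *: (S v - k' *: S w).
Proof. by rewrite linearD 2!linearZZ linearD linearN linearZZ. Qed.

(** The image of [a_N] under the antipode, solved for the product that starts with
[KV x * a x]. *)
Lemma a_SN_homs x t z : homs t z ->
  KV x * a x * S (N z) = sgn (par x && wpar t) *: (S (N z) * (KV x * a x))
  + (gden x)^-1 *: (S (N (dl x z)) * KV x
      - sgn (par x && (wpar t (+) par x)) *: (K x * S (N (dr x z)))).
Proof.
apply: (eq_linear_homs (f := fun z => KV x * a x * S (N z))
  (h := fun z => sgn (par x && wpar t) *: (S (N z) * (KV x * a x))
  + (gden x)^-1 *: (S (N (dl x z)) * KV x
      - sgn (par x && (wpar t (+) par x)) *: (K x * S (N (dr x z)))))).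
- by lin.
- by lin.
move=> s st; have := congr1 S (a_N x s).
rewrite S_lin4 SKN SNKV (S_mul (hom_a x) (hom_N s)) (S_mul (hom_N s) (hom_a x)).
rewrite S_a andbC mulrN mulNr !scalerN scalerA sgn_mul addbb /sgn expr0 scale1r.
rewrite -(perm_wpar st) => E.
move: E; set X := KV x * a x * _; set Y := _ *: (_ * (KV x * a x)).
set Z := (gden x)^-1 *: _ => E.
by apply: (@addrI _ (- X)); rewrite addNr addrCA addrC -E andbC addNr.
Qed.

End Antipode.
End Commutation.

(** * Dual bases and adjoint operators *)

Section DualBases.
Variables (D : datum) (T : eqType).
Local Notation L := (Iinf D).
Local Notation F := (freealg L).
Variables (B : F -> F -> Qq) (hB : is_form B).
Variables (Bs : NIinf D -> seq T) (xr yr : NIinf D -> T -> F).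
Local Notation em al := (enum_mset al).

(** Representatives [xr al b] and [yr al b] in the free algebra of a basis and of
its dual basis, modulo the radical. *)
Record dual_reps : Prop := DualReps {
  reps_uniq : forall al, uniq (Bs al);
  reps_x : forall al b, b \in Bs al -> homs (em al) (xr al b);
  reps_y : forall al b, b \in Bs al -> homs (em al) (yr al b);
  reps_dual : forall al b b', b \in Bs al -> b' \in Bs al ->
    B (xr al b) (yr al b') = (b == b')%:R;
  reps_span : forall al z, homs (em al) z -> exists c : T -> Qq,
    radical B (z - \sum_(b <- Bs al) c b *: xr al b)
}.
Hypothesis reps : dual_reps.
Implicit Types (al be : NIinf D) (b : T) (y z : F).

Lemma form_suml (r : seq T) (c : T -> Qq) (f : T -> F) z :
  B (\sum_(b <- r) c b *: f b) z = \sum_(b <- r) c b * B (f b) z.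
Proof.
have lB := lin_forml hB z; elim: r => [|b r IH].
  by have := form_scaler hB z 0 0; rewrite !big_nil scale0r mul0r (form_sym hB).
by rewrite !big_cons lB IH.
Qed.

Lemma form_sumr (r : seq T) (c : T -> Qq) (f : T -> F) z :
  B z (\sum_(b <- r) c b *: f b) = \sum_(b <- r) c b * B z (f b).
Proof.
by rewrite (form_sym hB) form_suml; apply: eq_bigr => b _; rewrite (form_sym hB).
Qed.

Lemma formBl y z w : B (y - z) w = B y w - B z w.
Proof.
have := form_linl hB w (- 1) z y; rewrite scaleN1r mulN1r [- z + y]addrC => ->.
by rewrite addrC.
Qed.

Lemma formBr y z w : B w (y - z) = B w y - B w z.
Proof. by rewrite !(form_sym hB w) formBl. Qed.

Lemma sum_delta (r : seq T) (c : T -> Qq) b : uniq r -> b \in r ->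
  \sum_(b' <- r) c b' * (b' == b)%:R = c b.
Proof.
move=> ur br; rewrite (bigD1_seq b) //= eqxx mulr1 big1 ?addr0 // => b' /negPf->.
by rewrite mulr0.
Qed.

(** The coefficients are found by pairing with the dual basis. *)
Lemma expand_x al z : homs (em al) z ->
  radical B (z - \sum_(b <- Bs al) B z (yr al b) *: xr al b).
Proof.
move=> hz; have [c rc] := reps_span reps hz.
suff -> : \sum_(b <- Bs al) B z (yr al b) *: xr al b
  = \sum_(b <- Bs al) c b *: xr al b by [].
apply: eq_big_seq => b hb; congr (_ *: _).
have /eqP := rc (yr al b); rewrite formBl subr_eq0 => /eqP ->.
rewrite form_suml -[RHS](sum_delta c (reps_uniq reps al) hb).
by apply: eq_big_seq => b' hb'; rewrite (reps_dual reps).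
Qed.

(** Conversely the [yr al b] span their degree modulo the radical: the difference
pairs to zero with the [xr al b], hence with every word of degree [al] by
[expand_x], and with all other words by orthogonality. *)
Lemma expand_y al z : homs (em al) z ->
  radical B (z - \sum_(b <- Bs al) B (xr al b) z *: yr al b).
Proof.
move=> hz; set u := z - _.
have hu : homs (em al) u.
  apply: homsD => //; rewrite -scaleN1r; apply: homsZ; apply: homs_sum => b hb.
  exact/homsZ/(reps_y reps).
have xu b : b \in Bs al -> B (xr al b) u = 0.
  move=> hb; apply/eqP; rewrite formBr subr_eq0 form_sumr; apply/eqP.
  rewrite -[LHS](sum_delta (fun b => B (xr al b) z) (reps_uniq reps al) hb).
  apply: eq_big_seq => b' hb'; rewrite (reps_dual reps) // eq_sym.
  by [].
move=> v; rewrite (form_sym hB).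
suff /(_ v) : (B^~ u : F -> Qq^o) =1 (fun=> 0) by [].
apply: eq_linear_mon; first exact: (lin_forml hB).
  by move=> c v1 v2; rewrite scaler0 addr0.
move=> w; have [wal|wal] := boolP (perm_eq w (em al)); last exact: (form_orth hB hu).
have := expand_x (homs_mon wal) u; rewrite formBl => /eqP; rewrite subr_eq0 => /eqP ->.
by rewrite form_suml big1_seq // => b /andP[_ hb]; rewrite xu // mulr0.
Qed.

Lemma expand_fx (V : lmodType Qq) (f : F -> V) al z : linear f ->
  (forall z, radical B z -> f z = 0) -> homs (em al) z ->
  f z = \sum_(b <- Bs al) B z (yr al b) *: f (xr al b).
Proof.
move=> lf fr hz; pose f' : {linear F -> V} := HB.pack f (GRing.isLinear.Build _ _ _ _ f lf).
have /eqP := fr _ (expand_x hz); rewrite -[f]/(f' : F -> V) linearB subr_eq0 => /eqP ->.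
by rewrite linear_sum; apply: eq_bigr => b _; rewrite linearZ.
Qed.

Lemma expand_fy (V : lmodType Qq) (f : F -> V) al z : linear f ->
  (forall z, radical B z -> f z = 0) -> homs (em al) z ->
  f z = \sum_(b <- Bs al) B (xr al b) z *: f (yr al b).
Proof.
move=> lf fr hz; pose f' : {linear F -> V} := HB.pack f (GRing.isLinear.Build _ _ _ _ f lf).
have /eqP := fr _ (expand_y hz); rewrite -[f]/(f' : F -> V) linearB subr_eq0 => /eqP ->.
by rewrite linear_sum; apply: eq_bigr => b _; rewrite linearZ.
Qed.

(** The sum over a basis and its dual basis is the canonical element of the
pairing, so an operator on the left factors can be replaced by its adjoint on the
right factors. Both sides expand to the double sum of the matrix coefficients
B (A (xr al b)) (yr be b'). *)
Lemma canonical_adjoint (U : algType Qq) (f g : F -> U) (A A' : F -> F) al be :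
  linear f -> linear g ->
  (forall z, radical B z -> f z = 0) -> (forall z, radical B z -> g z = 0) ->
  (forall z, homs (em al) z -> homs (em be) (A z)) ->
  (forall z, homs (em be) z -> homs (em al) (A' z)) ->
  (forall y z, B (A y) z = B y (A' z)) ->
  \sum_(b <- Bs al) f (A (xr al b)) * g (yr al b)
  = \sum_(b <- Bs be) f (xr be b) * g (A' (yr be b)).
Proof.
move=> lf lg fr gr hA hA' adj.
transitivity (\sum_(b <- Bs al) \sum_(b' <- Bs be)
   B (A (xr al b)) (yr be b') *: (f (xr be b') * g (yr al b))).
  apply: eq_big_seq => b hb.
  rewrite (expand_fx lf fr (hA _ (reps_x reps hb))) mulr_suml.
  by apply: eq_bigr => b' _; rewrite scalerAl.
rewrite exchange_big /=; apply: eq_big_seq => b' hb'.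
rewrite (expand_fy lg gr (hA' _ (reps_y reps hb'))) mulr_sumr.
by apply: eq_bigr => b _; rewrite adj scalerAr.
Qed.

End DualBases.

(** * The homogeneous components of the quasi-R-matrix *)

Section Sign.
Variable D : datum.
Local Notation L := (Iinf D).
Local Notation em al := (enum_mset al).
Implicit Types (x : L) (al be : NIinf D) (s : seq L).

Lemma perm_em_add x be : perm_eq (em (x +` be)%mset) (x :: em be).
Proof.
apply/allP => g _ /=; rewrite count_mem_mset mset1DE count_mem_mset.
by rewrite [g == x]eq_sym.
Qed.

Lemma sum_pairs (f : nat -> bool) n :
  (\sum_(r < n) \sum_(r' < n | (r < r')%N) f r * f r' = 'C(\sum_(r < n) f r, 2))%N.
Proof.
elim: n => [|n IH]; first by rewrite !big_ord0.
rewrite big_ord_recr /= [X in (_ + X)%N]big1 ?addn0; last first.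
  by move=> r'; rewrite ltnNge -ltnS ltn_ord.
rewrite (eq_bigr (fun r : 'I_n => (\sum_(r' < n | (r < r')%N) f r * f r')
     + f r * f n)%N); last first.
  by move=> r _; rewrite big_mkcond big_ord_recr /= ltn_ord -big_mkcond.
rewrite big_split /= IH -big_distrl /= big_ord_recr /=.
case: (f n) => /=; last by rewrite muln0 !addn0.
by rewrite muln1 addn1 binS bin1.
Qed.

(** Only pairs of odd letters contribute to e(al). *)
Lemma esignE al : esign al = 'C(count (@par D) (em al), 2).
Proof.
rewrite /esign; case: (enum_mset al) => [|x0 s]; first by rewrite big_ord0 /= bin0n.
move: (x0 :: s) => {}s.
transitivity (\sum_(r < size s) \sum_(r' < size s | (r < r')%N)
   par (nth x0 s r) * par (nth x0 s r'))%N.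
  by apply: eq_bigr => r _; apply: eq_bigr => r' _; rewrite !(tnth_nth x0).
rewrite (sum_pairs (fun r => par (nth x0 s r))); congr 'C(_, 2).
rewrite -sum1_count [RHS]big_mkcond [RHS](big_nth x0) big_mkord.
by apply: eq_bigr => i _; case: (par _).
Qed.

Lemma odd_count_par s : odd (count (@par D) s) = wpar s.
Proof.
elim: s => [|x s IH]; first by rewrite wpar0.
by rewrite wpar_cons /= oddD IH; case: (par x).
Qed.

Definition sgOm al : Qq := (-1) ^+ (ht al + esign al).

(** A new letter adds one to the height; if it is odd, it also forms one new pair
with each odd letter already present. *)
Lemma sgOm_add x be :
  sgOm (x +` be)%mset = - (sgn (par x && wpar (em be)) * sgOm be).
Proof.
rewrite /sgOm !esignE /ht (perm_size (perm_em_add x be)).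
rewrite (permP (perm_em_add x be)) /= addSn exprS mulN1r; congr (- _).
rewrite -odd_count_par; move: (count _ _) => k.
case: (par x); last by rewrite add0n /sgn expr0 mul1r.
rewrite add1n binS bin1 addnA exprD mulrC; congr (_ * _).
by rewrite /sgn signr_odd.
Qed.

Lemma wpar_em_add x be : wpar (em (x +` be)%mset) = par x (+) wpar (em be).
Proof. by rewrite (perm_wpar (perm_em_add x be)) wpar_cons. Qed.

End Sign.

Section Omega.
Variables (D : datum) (U : algType Qq) (T : eqType).
Local Notation L := (Iinf D).
Local Notation F := (freealg L).
Local Notation em al := (enum_mset al).
Implicit Types (x : L) (al be : NIinf D) (z : F).
Variables (a b K KV : L -> U) (S : {linear U -> U}) (hom : bool -> U -> Prop).
Hypothesis rel : double_relations a b K KV.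
Hypothesis srel : antipode_relations a b K KV S hom.
Variables (B : F -> F -> Qq) (hB : is_form B).
Variables (Bs : NIinf D -> seq T) (xr yr : NIinf D -> T -> F).
Hypothesis reps : dual_reps B Bs xr yr.
Local Notation P := (freeval a).
Local Notation N := (freeval b).
Hypothesis P_rad : forall z, radical B z -> P z = 0.
Hypothesis N_rad : forall z, radical B z -> N z = 0.

(** The component of degree [al] of Omega. *)
Definition Om al : U :=
  sgOm al *: \sum_(v <- Bs al) S (N (xr al v)) * P (yr al v).

(** What remains of [Om al] when [KV x * a x] has passed the left factors, or [b x]
the right factors. *)
Definition Xa x al : U := (sgOm al * sgn (par x && wpar (em al))) *:
  \sum_(v <- Bs al) S (N (xr al v)) * (KV x * a x) * P (yr al v).
Definition Yb x al : U := (sgOm al * sgn (par x && wpar (em al))) *: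
  \sum_(v <- Bs al) S (N (xr al v)) * b x * P (yr al v).

Lemma a_Om x al : KV x * a x * Om al = Xa x al
  + sgOm al *: ((gden x)^-1 *: (\sum_(v <- Bs al)
        S (N (dl x (xr al v))) * KV x * P (yr al v))
      - (gden x)^-1 *: (sgn (par x && (wpar (em al) (+) par x)) *:
        (\sum_(v <- Bs al) K x * S (N (dr x (xr al v))) * P (yr al v)))).
Proof.
rewrite /Om /Xa -scalerAr -scalerA -scalerDr; congr (_ *: _).
rewrite mulr_sumr !scaler_sumr -sumrB -big_split /=.
apply: eq_big_seq => v hv.
rewrite [KV x * a x * (_ * _)]mulrA (a_SN_homs rel srel x (reps_x reps hv)).
rewrite mulrDl -scalerAl; apply: congr2 => //.
by rewrite -scalerAl mulrBl scalerBr -[(_ *: (K x * _)) * _]scalerAl.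
Qed.

Lemma Om_b x al : Om al * b x = Yb x al
  + sgOm al *: ((gden x)^-1 *: (\sum_(v <- Bs al)
        S (N (xr al v)) * (P (dr x (yr al v)) * K x))
      - (gden x)^-1 *: (sgn (par x && (wpar (em al) (+) par x)) *:
        (\sum_(v <- Bs al) S (N (xr al v)) * (KV x * P (dl x (yr al v)))))).
Proof.
rewrite /Om /Yb -scalerAl -scalerA -scalerDr; congr (_ *: _).
rewrite mulr_suml !scaler_sumr -sumrB -big_split /=.
apply: eq_big_seq => v hv.
rewrite -[S _ * _ * b x]mulrA (P_b_homs rel x (reps_y reps hv)).
rewrite mulrDr; apply: congr2; first by rewrite -scalerAr mulrA.
by rewrite -scalerAr mulrBr scalerBr -!scalerAr.
Qed.

Lemma scale_dl_adjoint x y z : B ((gden x)^-1 *: dl x y) z = B y (gen x * z).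
Proof.
by rewrite (form_sym hB) form_scaler // (form_sym hB _ (gen x * z)) form_genl.
Qed.

Lemma scale_dr_adjoint x y z : B ((gden x)^-1 *: dr x y) z = B y (z * gen x).
Proof.
by rewrite (form_sym hB) form_scaler // (form_sym hB _ (z * gen x)) form_genr.
Qed.

Lemma homs_em_dl x be z : homs (em (x +` be)%mset) z -> homs (em be) (dl x z).
Proof. by move=> hz; apply/homs_dl/(homs_perm _ hz)/perm_em_add. Qed.

Lemma homs_em_dr x be z : homs (em (x +` be)%mset) z -> homs (em be) (dr x z).
Proof. by move=> hz; apply/homs_dr/(homs_perm _ hz)/perm_em_add. Qed.

Lemma homs_em_genl x be z : homs (em be) z -> homs (em (x +` be)%mset) (gen x * z).
Proof.
move=> hz; apply: homs_perm (homs_genl hz).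
by rewrite perm_sym perm_em_add.
Qed.

Lemma homs_em_genr x be z : homs (em be) z -> homs (em (x +` be)%mset) (z * gen x).
Proof.
move=> hz; apply: homs_perm (homs_genr hz).
by rewrite perm_sym perm_em_add.
Qed.

Lemma SN_scale (c : Qq) z u v : c *: (S (N z) * u * v) = S (N (c *: z)) * u * v.
Proof. by rewrite freevalZ linearZ -!scalerAl. Qed.

Lemma SN_scale' (c : Qq) z u v : c *: (u * S (N z) * v) = u * S (N (c *: z)) * v.
Proof. by rewrite freevalZ linearZ -!scalerAr -scalerAl. Qed.

Lemma P_scale (c : Qq) z u v : c *: (u * (P z * v)) = u * (P (c *: z) * v).
Proof. by rewrite freevalZ -scalerAl -scalerAr. Qed.

Lemma P_scale' (c : Qq) z u v : c *: (u * (v * P z)) = u * (v * P (c *: z)).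
Proof. by rewrite freevalZ -!scalerAr. Qed.

(** Four applications of [canonical_adjoint] between the degrees [be] and [x + be].
In the first two, a derivation of the left factors becomes a multiplication of the
right ones; in the last two it is the other way round, and the antipode turns the
multiplication into one by [b x * K x] on the opposite side. *)
Lemma sum_dl_x x be :
  (gden x)^-1 *: (\sum_(v <- Bs (x +` be)%mset)
     S (N (dl x (xr (x +` be)%mset v))) * KV x * P (yr (x +` be)%mset v))
  = \sum_(v <- Bs be) S (N (xr be v)) * (KV x * a x) * P (yr be v).
Proof.
rewrite scaler_sumr; under eq_bigr do rewrite SN_scale.
rewrite (canonical_adjoint hB reps (f := fun z => S (N z) * KV x) (g := P)
  (A := fun z => (gden x)^-1 *: dl x z) (A' := fun z => gen x * z) (be := be)).
- by apply: eq_bigr => v _; rewrite freeval_genl !mulrA.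
- by lin.
- by lin.
- by move=> z /N_rad ->; rewrite linear0 mul0r.
- exact: P_rad.
- by move=> z /homs_em_dl hz; apply: homsZ.
- exact: homs_em_genl.
- exact: scale_dl_adjoint.
Qed.

Lemma sum_dr_x x be :
  (gden x)^-1 *: (\sum_(v <- Bs (x +` be)%mset)
     K x * S (N (dr x (xr (x +` be)%mset v))) * P (yr (x +` be)%mset v))
  = \sum_(v <- Bs be) K x * (S (N (xr be v)) * P (yr be v)) * a x.
Proof.
rewrite scaler_sumr; under eq_bigr do rewrite SN_scale'.
rewrite (canonical_adjoint hB reps (f := fun z => K x * S (N z)) (g := P)
  (A := fun z => (gden x)^-1 *: dr x z) (A' := fun z => z * gen x) (be := be)).
- by apply: eq_bigr => v _; rewrite freeval_genr !mulrA.
- by lin.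
- by lin.
- by move=> z /N_rad ->; rewrite linear0 mulr0.
- exact: P_rad.
- by move=> z /homs_em_dr hz; apply: homsZ.
- exact: homs_em_genr.
- exact: scale_dr_adjoint.
Qed.

Lemma sum_dr_y x be :
  (gden x)^-1 *: (\sum_(v <- Bs (x +` be)%mset)
     S (N (xr (x +` be)%mset v)) * (P (dr x (yr (x +` be)%mset v)) * K x))
  = - (sgn (par x && wpar (em be)) *:
      \sum_(v <- Bs be) b x * K x * (S (N (xr be v)) * P (yr be v)) * K x).
Proof.
rewrite scaler_sumr; under eq_bigr do rewrite P_scale.
rewrite -(canonical_adjoint hB reps (f := fun z => S (N z)) (g := fun z => P z * K x)
  (A' := fun z => (gden x)^-1 *: dr x z) (A := fun z => z * gen x) (al := be)).
- rewrite scaler_sumr -sumrN; apply: eq_big_seq => v hv.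
  by rewrite (S_genr srel x (reps_x reps hv)) mulNr -scalerAl !mulrA.
- by lin.
- by lin.
- by move=> z /N_rad ->; rewrite linear0.
- by move=> z /P_rad ->; rewrite mul0r.
- exact: homs_em_genr.
- by move=> z /homs_em_dr hz; apply: homsZ.
- by move=> y z; rewrite (form_sym hB) -scale_dr_adjoint (form_sym hB).
Qed.

Lemma sum_dl_y x be :
  (gden x)^-1 *: (\sum_(v <- Bs (x +` be)%mset)
     S (N (xr (x +` be)%mset v)) * (KV x * P (dl x (yr (x +` be)%mset v))))
  = - (sgn (par x && wpar (em be)) *:
      \sum_(v <- Bs be) S (N (xr be v)) * b x * P (yr be v)).
Proof.
rewrite scaler_sumr; under eq_bigr do rewrite P_scale'.
rewrite -(canonical_adjoint hB reps (f := fun z => S (N z)) (g := fun z => KV x * P z)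
  (A' := fun z => (gden x)^-1 *: dl x z) (A := fun z => gen x * z) (al := be)).
- rewrite scaler_sumr -sumrN; apply: eq_big_seq => v hv.
  rewrite (S_genl srel x (reps_x reps hv)) mulNr -scalerAl !mulrA.
  by rewrite -[_ * K x * KV x]mulrA (rel_KKV rel) mulr1.
- by lin.
- by lin.
- by move=> z /N_rad ->; rewrite linear0.
- by move=> z /P_rad ->; rewrite mulr0.
- exact: homs_em_genl.
- by move=> z /homs_em_dl hz; apply: homsZ.
- by move=> y z; rewrite (form_sym hB) -scale_dl_adjoint (form_sym hB).
Qed.

Lemma scalerCA (V : lmodType Qq) (c d : Qq) (u : V) : c *: (d *: u) = d *: (c *: u).
Proof. by rewrite !scalerA mulrC. Qed.

Lemma sgn_sq (c : bool) : sgn c * sgn c = 1.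
Proof. by rewrite sgn_mul addbb /sgn expr0. Qed.

(** By [sum_dl_x] the left derivatives give the error term of degree [be], and by
[sum_dr_x] the right derivatives give [Om be]; the sign [sgOm_add] makes the former
cancel against the error term of degree [be] itself. *)
Lemma a_Om_add x be : KV x * a x * Om (x +` be)%mset
  = Xa x (x +` be)%mset - Xa x be + K x * Om be * a x.
Proof.
rewrite a_Om scalerCA sum_dl_x sum_dr_x -addrA; apply: congr2 => //.
rewrite wpar_em_add sgOm_add -mulr_suml -mulr_sumr.
rewrite (addbC (par x)) -addbA addbb addbF scalerBr scalerA; apply: congr2.
  by rewrite /Xa scaleNr [_ * sgOm be]mulrC.
by rewrite mulNr mulrAC sgn_sq mul1r scaleNr opprK /Om -scalerAr -scalerAl.
Qed.

Lemma a_Om_notin x al : x \notin em al -> KV x * a x * Om al = Xa x al.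
Proof.
move=> xal; rewrite a_Om [X in _ - X]scalerCA !big1_seq ?scaler0 ?subr0 ?scaler0 ?addr0 //.
  by move=> v /andP[_ hv]; rewrite (dr_notin xal (reps_x reps hv)) !linear0 mulr0 mul0r.
by move=> v /andP[_ hv]; rewrite (dl_notin xal (reps_x reps hv)) !linear0 !mul0r.
Qed.

Lemma Om_b_add x be : Om (x +` be)%mset * b x
  = Yb x (x +` be)%mset - Yb x be + b x * K x * Om be * K x.
Proof.
rewrite Om_b scalerCA sum_dl_y sum_dr_y -addrA; apply: congr2 => //.
rewrite wpar_em_add sgOm_add -mulr_suml -mulr_sumr.
rewrite (addbC (par x)) -addbA addbb addbF !scalerN opprK !scalerA sgn_sq scale1r.
rewrite addrC scalerDr; apply: congr2.
  rewrite scalerN scaleNr opprK scalerA mulrAC sgn_sq mul1r.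
  by rewrite /Om -scalerAr -scalerAl.
by rewrite /Yb scaleNr [_ * sgOm be]mulrC.
Qed.

Lemma Om_b_notin x al : x \notin em al -> Om al * b x = Yb x al.
Proof.
move=> xal; rewrite Om_b [X in _ - X]scalerCA !big1_seq ?scaler0 ?subr0 ?scaler0 ?addr0 //.
  by move=> v /andP[_ hv]; rewrite (dl_notin xal (reps_y reps hv)) !linear0 !mulr0.
by move=> v /andP[_ hv]; rewrite (dr_notin xal (reps_y reps hv)) !linear0 mul0r mulr0.
Qed.

(** The two factors of each term have opposite weights. *)
Lemma Om_K x al : Om al * K x = K x * Om al.
Proof.
rewrite /Om -scalerAl -scalerAr mulr_suml mulr_sumr; congr (_ *: _).
apply: eq_big_seq => v hv; rewrite -mulrA; have := K_P_homs rel x (reps_y reps hv).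
have := K_SN_homs rel srel x (reps_x reps hv).
move: (S _) (P _) => s p Es Ep.
have -> : p * K x = q ^ (- wwt x (em al)) *: (K x * p).
  by rewrite Ep scalerA -expfzDr ?q_neq0 // addNr expr0z scale1r.
rewrite -scalerAr !mulrA Es -scalerAl scalerA -expfzDr ?q_neq0 // addNr.
by rewrite expr0z scale1r.
Qed.

End Omega.

(** * Local finiteness on integrable modules *)

Lemma finite_words (T : choiceType) (A : set T) n : finite_set A ->
  finite_set [set w : seq T | (size w <= n)%N /\ forall x, x \in w -> A x].
Proof.
move=> finA; elim: n => [|n IH].
  apply: (@sub_finite_set _ _ [set [::]]); last exact: finite_set1.
  by move=> w /= [+ _]; rewrite leqn0 size_eq0 => /eqP.
set E := [set w | _] in IH.
apply: (@sub_finite_set _ _ ([set [::]] `|` (fun p : T * seq T => p.1 :: p.2) @` (A `*` E))).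
  move=> [|x w] /= [sw wA]; first by left.
  right; exists (x, w) => //; split; first by apply: wA; rewrite inE eqxx.
  by split=> // y yw; apply: wA; rewrite inE yw orbT.
rewrite finite_setU; split; first exact: finite_set1.
by apply: finite_image; apply: finite_setX.
Qed.

Section SimpleRoots.
Variable D : datum.
Local Notation L := (Iinf D).
Local Notation I := (idx D).
Implicit Types (x : L) (w : seq L) (u v : seq I).

Definition lsum u : wlat D := \sum_(i <- u) alpha i.

Lemma lsum_count u (s : seq I) : uniq s -> {subset u <= s} ->
  lsum u = \sum_(i <- s) alpha i *+ count_mem i u.
Proof.
move=> us; rewrite /lsum; elim: u => [|j u IH] sub.
  by rewrite big_nil big1 // => i _; rewrite mulr0n.
rewrite big_cons IH => [|i iu]; last by apply: sub; rewrite inE iu orbT.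
under [RHS]eq_bigr do rewrite /= mulrnDr.
rewrite big_split /=; congr (_ + _).
rewrite (bigD1_seq j) //=; last by apply: sub; rewrite inE eqxx.
by rewrite eqxx mulr1n big1 ?addr0 // => i /negPf ij; rewrite eq_sym ij mulr0n.
Qed.

Lemma alpha_independent : Zindependent (@alpha D).
Proof. by case: (D). Qed.

Lemma lsum_inj u v : lsum u = lsum v -> perm_eq u v.
Proof.
pose s := undup (u ++ v); have us : uniq s by apply: undup_uniq.
have su : {subset u <= s} by move=> i iu; rewrite mem_undup mem_cat iu.
have sv : {subset v <= s} by move=> i iv; rewrite mem_undup mem_cat iv orbT.
rewrite (lsum_count us su) (lsum_count us sv) => /eqP; rewrite -subr_eq0 -sumrB => /eqP E.
pose c i : int := (count_mem i u)%:Z - (count_mem i v)%:Z.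
have c0 i : i \in s -> c i = 0.
  apply: (@alpha_independent s c us); rewrite -[RHS]E; apply: eq_bigr => j _.
  by rewrite /c mulrzBr !pmulrn.
apply/allP => i; rewrite -mem_undup -/s => /c0 /eqP.
by rewrite subr_eq0 eqz_nat.
Qed.

(** The weight of a word as a list of simple roots: the letter (i, l) stands for l
copies of i. *)
Definition expand w : seq I := flatten [seq nseq (lv x) (ix x) | x <- w].
Definition wtw w : wlat D := lsum (expand w).

Lemma lv_gt0 x : (0 < lv x)%N.
Proof.
rewrite /lv; case: x => -[i l] /=.
by rewrite /inf_pred /= => /orP[/andP[_ /eqP->]|/andP[]].
Qed.

Lemma expand_cons x w : expand (x :: w) = nseq (lv x) (ix x) ++ expand w.
Proof. by []. Qed.

Lemma lsum_cat u v : lsum (u ++ v) = lsum u + lsum v.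
Proof. exact: big_cat. Qed.

Lemma lsum_nseq n i : lsum (nseq n i) = alpha i *+ n.
Proof. by rewrite /lsum big_nseq iter_addr_0. Qed.

Lemma size_expand w : (size w <= size (expand w))%N.
Proof.
elim: w => //= x w IH; rewrite expand_cons size_cat size_nseq -add1n.
by rewrite leq_add ?lv_gt0.
Qed.

Lemma expand_letter x w : x \in w ->
  ix x \in expand w /\ (lv x <= size (expand w))%N.
Proof.
elim: w => //= y w IH; rewrite inE expand_cons size_cat size_nseq mem_cat.
case/orP => [/eqP<-|/IH[-> le]]; last by rewrite orbT (leq_trans le) ?leq_addl.
by rewrite mem_nseq lv_gt0 eqxx leq_addr.
Qed.

Lemma Qplus_lsum b : @Qplus D b -> exists u, b = lsum u.
Proof.
move=> [s [c ->]]; exists (flatten [seq nseq (c i) i | i <- s]).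
elim: s => [|i s IH]; first by rewrite /lsum !big_nil.
by rewrite /= lsum_cat -IH big_cons lsum_nseq.
Qed.

Lemma finite_letters u n :
  finite_set [set x : L | ix x \in u /\ (lv x <= n)%N].
Proof.
pose pl := [seq (i, l) | i <- u, l <- iota 0 n.+1].
apply: (@sub_finite_set _ _ [set` pmap (insub : I * nat -> option L) pl]).
  move=> x /= [xu xn]; rewrite mem_pmap; apply/mapP.
  exists (val x); last by rewrite valK.
  apply/allpairsP; exists (ix x, lv x); split => //; last exact: surjective_pairing.
  by rewrite mem_iota /= add0n ltnS.
exact: finite_seq.
Qed.

(** As soon as there is one such word, [la] is a sum of simple roots, unique up to
order by linear independence, and the expansion of every such word is part of it. *)
Lemma finite_words_below (la : wlat D) :
  finite_set [set w : seq L | exists2 b, @Qplus D b & la = wtw w + b].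
Proof.
set E := [set w | _]; have [[w0 [b0 /Qplus_lsum[u0 ->] E0]]|noE] := pselect (E !=set0); last first.
  by apply: (@sub_finite_set _ _ set0) => // w Ew; apply: noE; exists w.
pose u := expand w0 ++ u0.
apply: (@sub_finite_set _ _ [set w | (size w <= size u)%N /\
   forall x, x \in w -> ix x \in u /\ (lv x <= size u)%N]); last first.
  exact: (finite_words _ (finite_letters u (size u))).
move=> w [b /Qplus_lsum[v ->] Ew].
have /lsum_inj wu : lsum (expand w ++ v) = lsum u by rewrite !lsum_cat -[LHS]Ew E0.
have szu : (size (expand w) <= size u)%N by rewrite -(perm_size wu) size_cat leq_addr.
split; first exact: leq_trans (size_expand w) szu.
move=> x /expand_letter[xw lx]; split; last exact: leq_trans lx szu.
by rewrite -(perm_mem wu) mem_cat xw.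
Qed.

End SimpleRoots.

Section Weights.
Variables (D : datum) (U : algType Qq) (M : lmodType U).
Local Notation L := (Iinf D).
Local Notation F := (freealg L).
Local Notation P := (wlat D).
Local Notation em al := (enum_mset al).
Implicit Types (x : L) (w : seq L) (m : M) (mu : P) (z : F).

Lemma kscale_act (c : Qq) (u : U) m : (c *: u) *: m = kscale c (u *: m).
Proof. by rewrite /kscale scalerA mulr_algl. Qed.

Lemma act_kscale (c : Qq) (u : U) m : u *: kscale c m = kscale c (u *: m).
Proof. by rewrite /kscale !scalerA mulr_algl mulr_algr. Qed.

Lemma kscaleA (c d : Qq) m : kscale c (kscale d m) = kscale (c * d) m.
Proof. by rewrite /kscale scalerA -scalerAl mul1r scalerA. Qed.

Variables (a : L -> U) (Q : Pdual P -> U).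
Hypothesis Q_a : forall (h : Pdual P) x,
  Q h * a x = q ^ ((lv x)%:Z * h (alpha (ix x))) *: (a x * Q h).

Definition weight_vector mu m : Prop :=
  forall h : Pdual P, Q h *: m = kscale (q ^ h mu) m.

Lemma weight_gen x mu m : weight_vector mu m ->
  weight_vector (mu + alpha (ix x) *+ lv x) (a x *: m).
Proof.
move=> hm h; rewrite scalerA Q_a kscale_act -scalerA hm act_kscale kscaleA.
by rewrite raddfD raddfMn /= expfzDr ?q_neq0 // mulrC -mulr_natl natz.
Qed.

Lemma weight_word w mu m : weight_vector mu m ->
  weight_vector (mu + wtw w) (freeval a (mon w) *: m).
Proof.
move=> hm; elim: w => [|x w IH].
  by rewrite freeval_1 scale1r /wtw /lsum big_nil addr0.
rewrite mon_cons freeval_genl -scalerA /wtw expand_cons lsum_cat lsum_nseq addrCA addrC.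
exact: weight_gen.
Qed.

Hypothesis bounded : exists ls : seq P, forall mu,
  (exists2 m, weight_vector mu m & m <> 0) ->
  exists2 l, l \in ls & exists2 b, @Qplus D b & mu = l - b.
Hypothesis weights : forall m, exists (s : seq P) (f : P -> M),
  (forall mu, weight_vector mu (f mu)) /\ m = \sum_(mu <- s) f mu.

(** A word acting nontrivially sends [mu] to a weight of the module, hence below one
of the finitely many bounds. *)
Lemma finite_words_weight mu m : weight_vector mu m ->
  finite_set [set w | freeval a (mon w) *: m <> 0].
Proof.
move=> hm; have [ls hls] := bounded.
apply: (@sub_finite_set _ _ (\bigcup_(l in [set` ls])
   [set w : seq L | exists2 b, @Qplus D b & l - mu = wtw w + b])); last first.
  by apply: bigcup_finite => [|l _]; [exact: finite_seq | exact: finite_words_below].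
move=> w /= w0; have [|l lls [b hb E]] := hls (mu + wtw w).
  by exists (freeval a (mon w) *: m) => //; apply: weight_word.
exists l => //; exists b => //.
by apply/eqP; rewrite subr_eq -addrA [b + mu]addrC addrA -subr_eq -E addrC.
Qed.

(** Every vector is a finite sum of weight vectors. *)
Lemma finite_words_nonzero m : finite_set [set w | freeval a (mon w) *: m <> 0].
Proof.
have [s [f [hf ->]]] := weights m.
apply: (@sub_finite_set _ _ (\bigcup_(mu in [set` s])
   [set w | freeval a (mon w) *: f mu <> 0])); last first.
  apply: bigcup_finite => [|mu _]; first exact: finite_seq.
  exact: finite_words_weight.
move=> w /=; apply: contra_notP => nw; rewrite scaler_sumr big1_seq // => mu /andP[_ mus].
by apply: contrapT => fmu; apply: nw; exists mu.
Qed.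

(** The exceptional degrees are those of the finitely many words that do not
annihilate [m]. *)
Lemma finitely_many_degrees m : exists A : {fset NIinf D},
  forall al, al \notin A -> forall z, homs (em al) z -> freeval a z *: m = 0.
Proof.
have /finite_fsetP[A EA] := finite_image (@seq_mset L) (finite_words_nonzero m).
exists A => al alA z hz; rewrite [z]malg_sum linear_sum scaler_suml big1_seq // => w /andP[_ wz].
rewrite linearZ /= kscale_act monE.
suff -> : freeval a (mon w) *: m = 0 by rewrite /kscale scaler0.
apply: contrapT => w0; move/negP: alA; apply.
suff : [set` A] al by [].
rewrite -EA; exists (w : seq L) => //.
by apply: etrans (seq_mset_id al); apply/eq_seq_msetP/hz.
Qed.

End Weights.

(** * Summation over all degrees *)

Section Telescoping.
Local Open Scope mset_scope.
Local Open Scope classical_set_scope.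
Local Open Scope ring_scope.
Variables (K : choiceType) (V : zmodType).
Implicit Types (A : {fset {mset K}}) (f g : {mset K} -> V).

Lemma fsumB A f g : (forall al, al \notin A -> f al = 0) ->
  (forall al, al \notin A -> g al = 0) ->
  \sum_(al \in [set: {mset K}]) (f al - g al)
  = \sum_(al \in [set: {mset K}]) f al - \sum_(al \in [set: {mset K}]) g al.
Proof.
move=> fA gA; rewrite (fsbigTE A) 1?(fsbigTE A f) 1?(fsbigTE A g) ?sumrB //.
by move=> al alA; rewrite fA // gA // subr0.
Qed.

(** The degrees containing [x] are the [x + be]. Subtracting [X] from [g] leaves
[h be - X be] in degree [x + be] and zero in all other degrees, so over all degrees
the sums of [X] cancel. *)
Lemma telescoping_sum A (x : K) (g X h : {mset K} -> V) :
  (forall al, al \notin A -> g al = 0) ->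
  (forall al, al \notin A -> X al = 0) ->
  (forall al, al \notin A -> h al = 0) ->
  (forall be, g (x +` be)%mset = X (x +` be)%mset - X be + h be) ->
  (forall al, x \notin al -> g al = X al) ->
  \sum_(al \in [set: {mset K}]) g al = \sum_(al \in [set: {mset K}]) h al.
Proof.
move=> gA XA hA g_add g_notin.
apply: (@addIr _ (- \sum_(al \in [set: {mset K}]) X al)).
rewrite -(fsumB gA XA) -(fsumB hA XA).
rewrite -(@fsbig_widen _ _ _ _ ((fun be => x +` be)%mset @` [set: {mset K}])) //.
  rewrite fsbig_image => [|be be' _ _]; last exact: (can_inj (msetDKB [mset x]%mset)).
  apply: eq_fsbigr => be _; apply/eqP; rewrite g_add subr_eq; apply/eqP.
  by rewrite [RHS]addrC addrA addrAC.
move=> al [_ nal]; rewrite /preimage /= g_notin ?subrr //.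
apply/negP => xal; apply: nal; exists (al `\ x)%mset => //.
exact: msetB1K.
Qed.

End Telescoping.

Section OmegaAction.
Variables (D : datum) (U : algType Qq) (T : eqType) (M : lmodType U).
Local Notation L := (Iinf D).
Local Notation F := (freealg L).
Local Notation em al := (enum_mset al).
Implicit Types (x : L) (al be : NIinf D) (z : F) (m : M).
Variables (a b K KV : L -> U) (S : {linear U -> U}) (hom : bool -> U -> Prop).
Hypothesis rel : double_relations a b K KV.
Hypothesis srel : antipode_relations a b K KV S hom.
Variables (B : F -> F -> Qq) (hB : is_form B).
Variables (Bs : NIinf D -> seq T) (xr yr : NIinf D -> T -> F).
Hypothesis reps : dual_reps B Bs xr yr.
Local Notation P := (freeval a).
Local Notation N := (freeval b).
Hypothesis P_rad : forall z, radical B z -> P z = 0.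
Hypothesis N_rad : forall z, radical B z -> N z = 0.
Hypothesis fin : forall m, exists A : {fset NIinf D},
  forall al, al \notin A -> forall z, homs (em al) z -> P z *: m = 0.
Local Notation Om := (Om a b S Bs xr yr).
Local Notation Xa := (Xa a b KV S Bs xr yr).
Local Notation Yb := (Yb a b S Bs xr yr).

(** The stable value of the partial sums of Omega on [m]. *)
Definition OmM m : M := \sum_(al \in [set: NIinf D]) Om al *: m.

Lemma sum_P_zero (c : Qq) (u : T -> U) al m :
  (forall z, homs (em al) z -> P z *: m = 0) ->
  (c *: \sum_(v <- Bs al) u v * P (yr al v)) *: m = 0.
Proof.
move=> m0; rewrite kscale_act scaler_suml big1_seq ?/kscale ?scaler0 // => v /andP[_ hv].
by rewrite -scalerA m0 ?scaler0 //; apply: (reps_y reps).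
Qed.

Lemma fsum_act (A : {fset NIinf D}) (u : U) (f : NIinf D -> M) :
  (forall al, al \notin A -> f al = 0) ->
  u *: (\sum_(al \in [set: NIinf D]) f al) = \sum_(al \in [set: NIinf D]) u *: f al.
Proof.
move=> fA; rewrite (fsbigTE A f) // (fsbigTE A) ?scaler_sumr // => al /fA ->.
by rewrite scaler0.
Qed.

Lemma a_OmM x m : (KV x * a x) *: OmM m = K x *: OmM (a x *: m).
Proof.
have [A1 f1] := fin m; have [A2 f2] := fin (a x *: m).
pose A := (A1 `|` A2)%fset.
have {}f1 al : al \notin A -> forall z, homs (em al) z -> P z *: m = 0.
  by rewrite inE negb_or => /andP[/f1].
have {}f2 al : al \notin A -> forall z, homs (em al) z -> P z *: (a x *: m) = 0.
  by rewrite inE negb_or => /andP[_ /f2].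
rewrite /OmM (fsum_act (A := A)) => [|al /f1 m0]; last exact: sum_P_zero.
rewrite (fsum_act (A := A)) => [|al /f2 m0]; last exact: sum_P_zero.
apply: (telescoping_sum (A := A) (x := x) (X := fun al => Xa x al *: m)).
- by move=> al /f1 m0; rewrite [Om al *: m]sum_P_zero ?scaler0.
- by move=> al /f1 m0; apply: sum_P_zero.
- by move=> al /f2 m0; rewrite [Om al *: _]sum_P_zero ?scaler0.
- move=> be; rewrite scalerA (a_Om_add rel srel hB reps P_rad N_rad).
  by rewrite scalerDl scalerBl !scalerA.
- by move=> al xal; rewrite scalerA (a_Om_notin rel srel reps).
Qed.

Lemma OmM_b x m : OmM (b x *: m) = (b x * K x) *: OmM (K x *: m).
Proof.
have [A1 f1] := fin m; have [A2 f2] := fin (b x *: m).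
have [A3 f3] := fin (K x *: m).
pose A := (A1 `|` A2 `|` A3)%fset.
have {}f1 al : al \notin A -> forall z, homs (em al) z -> P z *: m = 0.
  by rewrite !inE !negb_or => /andP[/andP[/f1]].
have {}f2 al : al \notin A -> forall z, homs (em al) z -> P z *: (b x *: m) = 0.
  by rewrite !inE !negb_or => /andP[/andP[_ /f2]].
have {}f3 al : al \notin A -> forall z, homs (em al) z -> P z *: (K x *: m) = 0.
  by rewrite !inE !negb_or => /andP[_ /f3].
rewrite /OmM (fsum_act (A := A)) => [|al /f3 m0]; last exact: sum_P_zero.
apply: (telescoping_sum (A := A) (x := x) (X := fun al => Yb x al *: m)).
- by move=> al /f2 m0; apply: sum_P_zero.
- by move=> al /f1 m0; apply: sum_P_zero.
- by move=> al /f3 m0; rewrite [Om al *: _]sum_P_zero ?scaler0.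
- move=> be; rewrite scalerA (Om_b_add rel srel hB reps P_rad N_rad).
  by rewrite scalerDl scalerBl !scalerA.
- by move=> al xal; rewrite scalerA (Om_b_notin S rel reps).
Qed.

Lemma OmM_K x m : OmM (K x *: m) = K x *: OmM m.
Proof.
have [A fA] := fin m.
rewrite /OmM (fsum_act (A := A)) => [|al /fA m0]; last exact: sum_P_zero.
by apply: eq_fsbigr => al _; rewrite !scalerA (Om_K rel srel reps).
Qed.

End OmegaAction.

(** * The quasi-R-matrix of the quantum group *)

Section Instances.
Variables (D : datum) (U : algType Qq) (pi : {lrmorphism freealg (Ugen D) -> U}).
Local Notation L := (Iinf D).
Local Notation F := (freealg L).
Local Notation em al := (enum_mset al).
Hypothesis hpi : presents pi.

Lemma quantum_relations : double_relations (ua pi) (ub pi) (uK pi) (uKV pi).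
Proof.
split.
- exact: KVK hpi.
- exact: KKV hpi.
- exact: K_a hpi.
- exact: K_b hpi.
- exact: a_b hpi.
Qed.

Lemma Uhom_word (w : seq (Ugen D)) :
  Uhom pi (\big[addb/false]_(g <- w) @Ugen_par D g) (\prod_(g <- w) pi (gen g)).
Proof.
exists (mon w); first by move=> w'; rewrite msupp_mon inE => /eqP ->.
elim: w => [|g w IH]; first by rewrite big_nil mon0 rmorph1.
by rewrite mon_cons big_cons (piM pi) IH.
Qed.

Lemma Uhom_gen (g : Ugen D) : Uhom pi (Ugen_par g) (pi (gen g)).
Proof. by have := Uhom_word [:: g]; rewrite !big_cons !big_nil addbF mulr1. Qed.

Lemma Uhom_minus (s : seq L) : Uhom pi (wpar s) (freeval (ub pi) (mon s)).
Proof.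
have := Uhom_word [seq (inl (inr x) : Ugen D) | x <- s].
by rewrite !big_map freeval_mon.
Qed.

Lemma antipode_quantum (S : U -> U) : is_antipode pi S ->
  antipode_relations (ua pi) (ub pi) (uK pi) (uKV pi) S (Uhom pi).
Proof.
move=> hS; split.
- move=> e e' u v hu hv; rewrite (antipode_mul hS hu hv) mulr_sign /sgn scaler_sign.
  by [].
- by move=> x; exact: (Uhom_gen (inl (inl x))).
- exact: Uhom_minus.
- by move=> x; exact: (Uhom_gen (inr _)).
- by move=> x; exact: (Uhom_gen (inr _)).
- exact: antipode_a hS.
- exact: antipode_b hS.
- by move=> x; rewrite /uK (antipode_q hS) KV_eq.
- move=> x; rewrite /uKV (antipode_q hS); congr uq; apply: Pdual_eq => v /=.
  by rewrite !mulNr opprK.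
Qed.

Lemma Uplus_homs al u : Uplus pi al u <-> exists2 z : F, homs (em al) z & plus pi z = u.
Proof.
split=> -[z hz zu]; exists z => // w wz.
  by apply/allP => g _ /=; rewrite count_mem_mset hz.
by move=> g; rewrite (permP (hz w wz)) count_mem_mset.
Qed.

Variables (B : F -> F -> Qq) (hB : is_form B) (hid : identifies pi B).
Variables (Bs : NIinf D -> seq U) (st : NIinf D -> U -> U).
Hypotheses (hBs : is_basis pi Bs) (hst : is_dual_basis pi B Bs st).

(** A homogeneous representative, to which the commutation formulas apply; [rep]
need not be homogeneous. *)
Definition hrep al (u : U) : F := xget 0 [set z | homs (em al) z /\ plus pi z = u].

Lemma hrepP al u : Uplus pi al u -> homs (em al) (hrep al u) /\ plus pi (hrep al u) = u.
Proof.
move=> /Uplus_homs[z hz zu].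
exact: (@xgetPex _ 0 [set z | homs (em al) z /\ plus pi z = u] (ex_intro _ z (conj hz zu))).
Qed.

Lemma repP al u : Uplus pi al u -> plus pi (rep pi u) = u.
Proof.
move=> /Uplus_homs[z _ zu].
exact: (@xgetPex _ 0 [set z | plus pi z = u] (ex_intro _ z zu)).
Qed.

Lemma plusB (y z : F) : plus pi (y - z) = plus pi y - plus pi z.
Proof. exact: (linearB (freeval (ua pi))). Qed.

Lemma minusB (y z : F) : minus pi (y - z) = minus pi y - minus pi z.
Proof. exact: (linearB (freeval (ub pi))). Qed.

Lemma rep_hrep al u : Uplus pi al u -> radical B (rep pi u - hrep al u).
Proof.
move=> hu; apply/(proj1 (hid _)).
by rewrite plusB (repP hu) (proj2 (hrepP hu)) subrr.
Qed.

Lemma radical_eq (y z : F) v : radical B (y - z) -> B y v = B z v.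
Proof. by move=> /(_ v) /eqP; rewrite formBl // subr_eq0 => /eqP. Qed.

Lemma reps_quantum : dual_reps B Bs hrep (fun al v => hrep al (st al v)).
Proof.
split.
- exact: basis_uniq hBs.
- by move=> al b /(Defs.basis_mem hBs) /hrepP[].
- by move=> al b /(dual_mem hst) /hrepP[].
- move=> al b b' hb hb'; rewrite -(dual_form hst hb hb') /formU.
  rewrite -(radical_eq _ (rep_hrep (Defs.basis_mem hBs hb))) (form_sym hB).
  by rewrite -(radical_eq _ (rep_hrep (dual_mem hst hb'))) (form_sym hB).
move=> al z hz; have [c Ec] : exists c : U -> Qq, plus pi z = \sum_(b <- Bs al) c b *: b.
  by apply: (basis_span hBs); apply/Uplus_homs; exists z.
exists c; apply/(proj1 (hid _)); rewrite plusB Ec; apply/eqP; rewrite subr_eq0; apply/eqP.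
rewrite /plus (linear_sum (freeval (ua pi))); apply: eq_big_seq => b hb.
by rewrite /= freevalZ; congr (_ *: _); case: (hrepP (Defs.basis_mem hBs hb)).
Qed.

Lemma toUminus_hrep al u : Uplus pi al u -> toUminus pi u = minus pi (hrep al u).
Proof.
move=> /rep_hrep hr; apply/eqP; rewrite -subr_eq0 /toUminus -minusB; apply/eqP.
by apply/(proj2 (hid _)).
Qed.

Variables (M : lmodType U) (Mp : bool -> set M).
Hypothesis hM : in_Oint pi Mp.

Lemma Oint_finite (m : M) : exists A : {fset NIinf D},
  forall al, al \notin A -> forall z, homs (em al) z -> freeval (ua pi) z *: m = 0.
Proof.
apply: (@finitely_many_degrees D U M (ua pi) (uq pi) (uq_a hpi)).
- exact: Oint_wt hM.
- exact: Oint_sum hM.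
Qed.

Lemma Omega_term_Om (S : {linear U -> U}) al (m : M) :
  Omega_term pi S Bs st al m
  = Om (ua pi) (ub pi) S Bs hrep (fun al v => hrep al (st al v)) al *: m.
Proof.
rewrite /Omega_term -scaler_suml; congr (_ *: m); rewrite /Om scaler_sumr.
apply: eq_big_seq => b hb; rewrite (toUminus_hrep (Defs.basis_mem hBs hb)).
case: (hrepP (dual_mem hst hb)) => _ E; rewrite -[in LHS]E.
by rewrite /sgOm -signr_odd mulr_sign -[in RHS]signr_odd scaler_sign.
Qed.

End Instances.

Theorem proposition4p4 (D : datum) (B : freealg (Iinf D) -> freealg (Iinf D) -> Qq)
    (U : algType Qq) (pi : {lrmorphism freealg (Ugen D) -> U}) (S : U -> U)
    (Bs : NIinf D -> seq U) (st : NIinf D -> U -> U)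
    (M : lmodType U) (Mp : bool -> set M) :
  is_form B -> presents pi -> identifies pi B -> is_antipode pi S ->
  is_basis pi Bs -> is_dual_basis pi B Bs st -> in_Oint pi Mp ->
  [/\ forall (n : nat) (m : M),
        finite_set [set al : NIinf D |
          (ht al <= n)%N /\ Omega_term pi S Bs st al m <> 0],
      forall m : M, exists N : nat, forall n : nat, (N <= n)%N ->
        Omega_le pi S Bs st n m = Omega_le pi S Bs st N m
    & forall Omega : M -> M,
        (forall m : M, exists N : nat, forall n : nat, (N <= n)%N ->
           Omega_le pi S Bs st n m = Omega m) ->
        forall (x : Iinf D) (m : M),
          [/\ uKV pi x *: (ua pi x *: Omega m) = uK pi x *: Omega (ua pi x *: m),
              Omega (ub pi x *: m)
                = ub pi x *: (uK pi x *: Omega (uK pi x *: m))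
            & Omega (uK pi x *: m) = uK pi x *: Omega m]].
Proof.
move=> hB hpi hid hS hBs hst hM.
pose S' : {linear U -> U} :=
  HB.pack S (GRing.isLinear.Build _ _ _ _ S (antipode_linear hS)).
have srel : antipode_relations (ua pi) (ub pi) (uK pi) (uKV pi) S' (Uhom pi).
  exact: antipode_quantum hS.
have rel := quantum_relations hpi.
have reps := reps_quantum hB hid hBs hst.
have P_rad z : radical B z -> freeval (ua pi) z = 0 by move/(proj1 (hid z)).
have N_rad z : radical B z -> freeval (ub pi) z = 0 by move/(proj2 (hid z)).
have fin := Oint_finite hpi hM.
pose OmS := Om (ua pi) (ub pi) S' Bs (hrep pi) (fun al v => hrep pi al (st al v)).
have termE al (m : M) : Omega_term pi S Bs st al m = OmS al *: m.
  exact: (Omega_term_Om hid hBs hst S').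
have term0 (m : M) : exists A : {fset NIinf D},
    forall al, al \notin A -> Omega_term pi S Bs st al m = 0.
  have [A fA] := fin m; exists A => al /fA m0; rewrite termE.
  exact: (sum_P_zero reps).
pose Omm (m : M) : M := OmM (ua pi) (ub pi) S' Bs (hrep pi) (fun al v => hrep pi al (st al v)) m.
have stable (m : M) : exists N, forall n, (N <= n)%N -> Omega_le pi S Bs st n m = Omm m.
  have [A fA] := term0 m.
  (* Beyond the largest height in [A] the bound on heights excludes only zero terms. *)
  exists (\max_(al <- A) ht al)%N => n le_n.
  rewrite /Omm /OmM; transitivity (\sum_(al \in [set: NIinf D]) Omega_term pi S Bs st al m).
    apply: fsbig_widen => // al [_ /negP]; rewrite -ltnNge => n_al; apply: fA.
    apply/negP => alA; move: n_al; rewrite ltnNge (leq_trans _ le_n) //.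
    exact: leq_bigmax_seq.
  by apply: eq_fsbigr => al _; rewrite termE.
split.
- move=> n m; have [A fA] := term0 m; apply: (@sub_finite_set _ _ [set` A]).
    by move=> al [_ nz]; apply: contrapT => /negP /fA.
  exact: finite_fset.
- by move=> m; have [N hN] := stable m; exists N => n le_n; rewrite !hN.
move=> Omega hOm.
have OmE (m : M) : Omega m = Omm m.
  have [N hN] := stable m; have [N' hN'] := hOm m.
  by rewrite -(hN (maxn N N')) ?leq_maxl // hN' ?leq_maxr.
move=> x m; rewrite !OmE; split.
- by rewrite scalerA; exact: (a_OmM rel srel hB reps P_rad N_rad fin).
- by rewrite scalerA; exact: (OmM_b rel srel hB reps P_rad N_rad fin).
- exact: (OmM_K rel srel reps fin).
Qed.
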